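(* Let $m\in\mathbb{N}$ and $n\le 2m$. Then $\widetilde{\Phi}^{(m)}\circ j^{(m)}$ agrees with the conditionally free product $*_{l\in\mathbb{N}}(\phi_l,\psi_l)$ on word products $w_1\ldots w_n$, where $w_1,\ldots,w_n$ are words in $\mathcal{A}_{k_1},\ldots,\mathcal{A}_{k_n}$, respectively, $k_1,\ldots,k_n\in\mathbb{N}$ and $k_1\ne k_2\ne\cdots\ne k_n$ (consecutive indices different). Thus, as $m\to\infty$, $\widetilde{\Phi}^{(m)}\circ j^{(m)}$ converges pointwise on $*_{l\in\mathbb{N}}\mathcal{A}_l$ to the conditionally free product of states $*_{l\in\mathbb{N}}(\phi_l,\psi_l)$.
   Context: Algebras and states. For each $l\in\mathbb{N}=\{1,2,\ldots\}$, $\mathcal{A}_l$ is the unital free *-algebra over $\mathbb{C}$ generated by a set $\mathcal{G}_l^+$: with $\mathcal{G}_l^-=\{a^*: a\in\mathcal{G}_l^+\}$ and $\mathcal{G}_l=\mathcal{G}_l^+\cup\mathcal{G}_l^-$, it is the free unital algebra on the letters $\mathcal{G}_l$, with words $a_1\ldots a_k$ ($a_i\in\mathcal{G}_l$) as linear basis, the empty word being the unit $\mathbf{1}$, and involution the antilinear extension of $(a_1\ldots a_k)^*=a_k^*\ldots a_1^*$. A state on a unital *-algebra is a linear functional $\phi$ with $\phi(\mathbf{1})=1$ and $\phi(xx^* )\ge 0$ for all $x$. $\phi_l,\psi_l$ are states on $\mathcal{A}_l$. Units are identified in the free product $*_{l\in\mathbb{N}}\mathcal{A}_l$. Boolean extension.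 $\widetilde{\mathcal{A}}_l=\mathcal{A}_l*\mathbb{C}[t]$ is the free product with units identified, $t=t^*$. For a state $\phi$ on $\mathcal{A}_l$, its Boolean extension $\widetilde{\phi}$ is the state on $\widetilde{\mathcal{A}}_l$ which is the linear extension of $\widetilde{\phi}(\mathbf{1})=1$ (more generally $\widetilde\phi(t^r)=1$) and $\widetilde{\phi}(t_0w_1t_1\ldots w_nt_n)=\phi(w_1)\ldots\phi(w_n)$, where $w_1,\ldots,w_n$ are non-empty words in $\mathcal{A}_l$ and $t_0,\ldots,t_n$ are powers of $t$, of which $t_1,\ldots,t_{n-1}\neq\mathbf{1}$. Infinite tensor product. $\widetilde{\mathcal{A}}^{(m)}=\bigotimes_{l\in\mathbb{N}}\widetilde{\mathcal{A}}_l^{\otimes m}$ is taken as the unital *-algebra spanned, inside the full algebraic infinite tensor product (the universal vector space for multilinear maps on $\prod_l\widetilde{\mathcal{A}}_l^{\otimes m}$, with componentwise multiplication and involution), by elementary tensors $\otimes_l x_l$, $x_l\in\widetilde{\mathcal{A}}_l^{\otimes m}$, in which all but finitely many $x_l$ are of the form $t^{r_1}\otimes\cdots\otimes t^{r_m}$ with $r_i\ge 0$. With $\widetilde{\Phi}_l^{(m)}=\widetilde{\phi}_l\otimes\widetilde{\psi}_l^{\otimes(m-1)}$ on $\widetilde{\mathcal{A}}_l^{\otimes m}$, the functional $\widetilde{\Phi}^{(m)}=\bigotimes_{l\in\mathbb{N}}\widetilde{\Phi}_l^{(m)}$ on $\widetilde{\mathcal{A}}^{(m)}$ is the linear extension of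 $\otimes_l x_l\mapsto\prod_l\widetilde{\Phi}^{(m)}_l(x_l)$ (all but finitely many factors equal $1$). The homomorphism. Put $I_k=\mathbf{1}^{\otimes k}$; for $x\in\widetilde{\mathcal{A}}_l$ and $1\le k\le m$ let $i_{k,m}(x)=I_{k-1}\otimes x\otimes I_{m-k}\in\widetilde{\mathcal{A}}_l^{\otimes m}$, with $i_{m+1,m}(a)=0$; and $t_{[k,m]}=I_{k-1}\otimes t^{\otimes(m-k+1)}$. For $a\in\mathcal{G}_l$, $$j_l^{(m)}(a)=\sum_{k=1}^m t_{[k,m]}^{\otimes(l-1)}\otimes(i_{k,m}(a)-i_{k+1,m}(a))\otimes t_{[k,m]}^{\otimes\infty},$$ the middle factor sitting in $\widetilde{\mathcal{A}}_l^{\otimes m}$. $j^{(m)}:*_{l\in\mathbb{N}}\mathcal{A}_l\to\widetilde{\mathcal{A}}^{(m)}$ is the unital *-homomorphism with $j^{(m)}(a)=j^{(m)}_l(a)$ for $a\in\mathcal{G}_l$, $l\in\mathbb{N}$. Conditionally free product. $\phi=*_{l\in\mathbb{N}}(\phi_l,\psi_l)$ is the state on $*_{l\in\mathbb{N}}\mathcal{A}_l$ determined by $\phi(\mathbf{1})=1$ and $\phi(a_1\ldots a_n)=\phi_{k_1}(a_1)\ldots\phi_{k_n}(a_n)$ whenever $a_j\in\mathcal{A}_{k_j}$, $\psi_{k_j}(a_j)=0$ and $k_1\ne k_2\ne\cdots\ne k_n$. *)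

(* Defs.v *)
From HB Require Import structures.
From mathcomp Require Import all_boot all_order all_algebra.
From mathcomp Require Import finmap monalg complex generic_quotient ring_quotient.
From mathcomp Require Import boolp classical_sets functions cardinality fsbigop.
From mathcomp Require Import reals topology normedtype.
Set Implicit Arguments.
Unset Strict Implicit.
Unset Printing Implicit Defensive.
Import Order.TTheory GRing.Theory Num.Theory.
Import numFieldNormedType.Exports.
Local Open Scope ring_scope.
Local Open Scope quotient_scope.

HB.mixin Record isStarAlgebra (C : numClosedFieldType) A
    of GRing.Algebra C A := {
  star : A -> A;
  starD : {morph star : x y / x + y};
  starZ : forall (c : C) (x : A), star (c *: x) = c^* *: star x;
  starM : forall x y : A, star (x * y) = star y * star x;
  starK : involutive star
}.

#[short(type="starAlgType")]
HB.structure Definition StarAlgebra (C : numClosedFieldType) :=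
  {A of GRing.Algebra C A & isStarAlgebra C A}.

Arguments star {C s} x.

Section StarTheory.
Context {C : numClosedFieldType} {A : starAlgType C}.

Lemma star1 : star (1 : A) = 1.
Proof. by rewrite -[LHS]mulr1 -[X in _ * X]starK -starM mulr1 starK. Qed.

Lemma star0 : star (0 : A) = 0.
Proof. by apply: (addIr (star 0)); rewrite -starD !add0r. Qed.

Lemma starN : {morph @star C A : x / - x}.
Proof. by move=> x; apply: (addIr (star x)); rewrite -starD !addNr star0. Qed.

Lemma star_sum (I : Type) (r : seq I) (P : pred I) (F : I -> A) :
  star (\sum_(i <- r | P i) F i) = \sum_(i <- r | P i) star (F i).
Proof. exact: (big_morph _ starD star0). Qed.

Definition is_state (phi : A -> C) : Prop :=
  [/\ scalar phi, phi 1 = 1 & forall x, 0 <= phi (x * star x)].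
End StarTheory.

Definition is_starhom (C : numClosedFieldType) (A B : starAlgType C)
    (h : A -> B) : Prop :=
  [/\ linear h, {morph h : x y / x * y}, h 1 = 1 & {morph h : x / star x}].

(* Semilinear extension of a map f defined on the basis K of {malg C[K]}. *)
Section LinExt.
Context {C : numClosedFieldType} {K : choiceType} {V : lmodType C}.
Implicit Types (s : {rmorphism C -> C}) (f : K -> V) (g : {malg C[K]}).

Definition linext s f g : V := \sum_(k <- msupp g) s g@_k *: f k.

Lemma linextEw s f (d : {fset K}) g : (msupp g `<=` d)%fset ->
  linext s f g = \sum_(k <- d) s g@_k *: f k.
Proof.
move=> le; rewrite [LHS](big_fset_incl _ le) => //= x xd /mcoeff_outdom ->.
by rewrite rmorph0 scale0r.
Qed.

Lemma linextU s f c k : linext s f << c *g k >> = s c *: f k.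
Proof. by rewrite (linextEw _ _ msuppU_le) big_seq_fset1 mcoeffUU. Qed.

Lemma linextP s f c g h :
  linext s f (c *: g + h) = s c *: linext s f g + linext s f h.
Proof.
pose d := (msupp g `|` msupp h)%fset.
have lg : (msupp g `<=` d)%fset by exact: fsubsetUl.
have lh : (msupp h `<=` d)%fset by exact: fsubsetUr.
have lgh : (msupp (c *: g + h) `<=` d)%fset.
  apply: fsubset_trans (msuppD_le _ _) _; rewrite fsubUset lh andbT.
  exact: fsubset_trans (msuppZ_le _ _) lg.
rewrite (linextEw _ _ lg) (linextEw _ _ lh) (linextEw _ _ lgh).
rewrite scaler_sumr -big_split /=; apply: eq_bigr => k _.
by rewrite mcoeffD mcoeffZ rmorphD rmorphM scalerDl scalerA.
Qed.

Lemma linext_comb s f1 f2 c g :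
  linext s (fun k => c *: f1 k + f2 k) g
  = c *: linext s f1 g + linext s f2 g.
Proof.
rewrite /linext scaler_sumr -big_split /=; apply: eq_bigr => k _.
by rewrite scalerDr !scalerA mulrC.
Qed.

Lemma linext_uniq s f (h : {malg C[K]} -> V) :
  (forall c x y, h (c *: x + y) = s c *: h x + h y) ->
  (forall k, h << k >> = f k) -> h =1 linext s f.
Proof.
move=> hP hU g; have h0 : h 0 = 0.
  by have := hP (-1) 0 0; rewrite scaler0 addr0 rmorphN1 scaleN1r addNr.
rewrite {1}[g]monalgE /linext.
elim: (msupp g : seq K) => [|k r IH]; first by rewrite !big_nil.
rewrite !big_cons -IH -hU -hP; congr (h (_ + _)).
by apply/malgP => k'; rewrite mcoeffZ !mcoeffU mulrnAr mulr1.
Qed.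
End LinExt.

Lemma lincong (R : pzRingType) (V : lmodType R) (c : R) (u u' v : V) :
  u = u' -> c *: u + v = c *: u' + v.
Proof. by move->. Qed.

Section SeparatingFunctional.
Local Open Scope classical_set_scope.
Context {C : fieldType} {V : lmodType C}.

Lemma separating_functional (v : V) : v != 0 ->
  exists f : V -> C, scalar f /\ f v = 1.
Proof.
move=> v0.
pose P (S : set V) := (forall (c : C) x y, S x -> S y -> S (c *: x + y)) /\ ~ S v.
have [F FP Ftot|M [[Mlin Mv] Mmax]] := @Zorn_bigcup V P.
  split=> [c x y [S FS Sx] [S' FS' Sy]|[S FS]]; last exact: (FP _ FS).2.
  have [SS'|S'S] := Ftot _ _ FS FS'.
    by exists S' => //; apply: (FP _ FS').1 => //; apply: SS'.
  by exists S => //; apply: (FP _ FS).1 => //; apply: S'S.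
pose M0 x := M x \/ x = 0.
have M0lin (c : C) x y : M0 x -> M0 y -> M0 (c *: x + y).
  move=> [Mx|->] [My|->]; rewrite ?scaler0 ?add0r ?addr0.
  - by left; apply: Mlin.
  - by left; have := Mlin (c - 1) _ _ Mx Mx; rewrite scalerBl scale1r subrK.
  - by left.
  - by right.
have M0v : ~ M0 v by move=> [//|/eqP]; apply/negP.
have spanv a : M0 a \/ exists2 c, c != 0 & M0 (v - c *: a).
  have [|aM] := pselect (M0 a); [by left|right].
  pose B : set V := [set z | exists c : C, M0 (z - c *: a)].
  have MB : M `<` B.
    split=> [x Mx|BM]; first by exists 0; rewrite scale0r subr0; left.
    by apply: aM; left; apply: BM; exists 1; rewrite scale1r subrr; right.
  have : B v.
    apply: contrapT => Bv; apply: (Mmax _ MB); split=> // c x y [d dx] [e ey].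
    exists (c * d + e); have := M0lin c _ _ dx ey.
    by rewrite scalerBr scalerA addrACA -opprD -scalerDl.
  move=> [c cv]; exists c => //; apply/eqP => c0.
  by apply: M0v; move: cv; rewrite c0 scale0r subr0.
have coef a : exists c : C, M0 (a - c *: v).
  have [aM|[c c0 cM]] := spanv a; first by exists 0; rewrite scale0r subr0.
  exists c^-1; have := M0lin (- c^-1) _ _ cM (or_intror erefl).
  by rewrite addr0 scalerBr scalerA mulNr mulVf // scaleN1r opprK addrC scaleNr.
pose f a := sval (cid (coef a)).
have fE a c : M0 (a - c *: v) -> f a = c.
  rewrite /f; case: cid => d /= da ca.
  apply/eqP; rewrite -subr_eq0; apply/negPn/negP => dc0; apply: M0v.
  have := M0lin (-1) _ _ da ca.
  rewrite scaleN1r opprB addrA subrK -scalerBl => /(M0lin (d - c)^-1 _ 0).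
  by rewrite addr0 scalerA mulVf // scale1r; apply; right.
exists f; split=> [c a b|]; last by apply: fE; rewrite scale1r subrr; right.
apply: fE; rewrite /f; case: cid => d /= da; case: cid => e /= eb.
have := M0lin c _ _ da eb.
by rewrite scalerBr scalerA addrACA -opprD -scalerDl.
Qed.
End SeparatingFunctional.

(* The algebraic tensor product of a family of *-algebras indexed by an
   arbitrary set I: the free vector space on the families x = (x_i)_i modulo
   the multilinearity relations.  [tensor_mk x] is the elementary tensor of x,
   and [tensor_lift] factors a multilinear map through the quotient. *)
Section TensorRelations.
Context {C : numClosedFieldType} {I : choiceType}.
Variable A : I -> starAlgType C.
Local Notation X := (forall i, A i).
Local Notation F := {malg C[X]}.
Implicit Types (x y : X) (s : {rmorphism C -> C}).

Inductive tensor_null : F -> Prop :=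
| tensor_null0 : tensor_null 0
| tensor_nullP c g h :
    tensor_null g -> tensor_null h -> tensor_null (c *: g + h)
| tensor_nullR x i (c : C) (a b : A i) :
    tensor_null (<< dfwith x (c *: a + b) >>
                 - (c *: << dfwith x a >> + << dfwith x b >>)).

Definition tensor_nullb : pred F := fun g => `[< tensor_null g >].

Lemma tensor_null_zmod : zmod_closed tensor_nullb.
Proof.
split=> [|g h /asboolP gn /asboolP hn]; first exact/asboolP/tensor_null0.
apply/asboolP; rewrite addrC -scaleN1r.
exact: tensor_nullP.
Qed.

HB.instance Definition _ := GRing.isZmodClosed.Build F tensor_nullb
  tensor_null_zmod.

Definition tensor_nullc := GRing.ZmodClosed.clone F tensor_nullb _.

Definition tensor : Type := Quotient.quot tensor_nullc.
End TensorRelations.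

HB.lock Definition tensor_pi (C : numClosedFieldType) (I : choiceType)
    (A : I -> starAlgType C) (g : {malg C[forall i, A i]}) : tensor A :=
  \pi_(Quotient.quot (tensor_nullc A)) g.

Arguments tensor_pi.body {C I} A%_function_scope g%_ring_scope.

HB.lock Definition tensor_repr (C : numClosedFieldType) (I : choiceType)
    (A : I -> starAlgType C) (q : tensor A) : {malg C[forall i, A i]} :=
  repr (q : Quotient.quot (tensor_nullc A)).

Definition tensor_mk (C : numClosedFieldType) (I : choiceType)
    (A : I -> starAlgType C) (x : forall i, A i) : tensor A :=
  tensor_pi A << x >>.

Section TensorModule.
Context {C : numClosedFieldType} {I : choiceType}.
Variable A : I -> starAlgType C.
Local Notation X := (forall i, A i).
Local Notation F := {malg C[X]}.
Local Notation T := (tensor A).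
Local Notation pi := (tensor_pi A).
Local Notation repr := (@tensor_repr C I A).
Local Notation null := (@tensor_null C I A).

Lemma tensor_reprK q : pi (repr q) = q.
Proof. by rewrite tensor_pi.unlock tensor_repr.unlock reprK. Qed.

Lemma tensor_piP (g h : F) : pi g = pi h <-> null (g - h).
Proof.
rewrite tensor_pi.unlock; split=> [/eqP|gh].
  by rewrite -Quotient.idealrBE => /asboolP.
by apply/eqP; rewrite -Quotient.idealrBE; apply/asboolP.
Qed.

Lemma tensor_nullZ (c : C) (g : F) : null g -> null (c *: g).
Proof.
by move=> gn; rewrite -[_ *: _]addr0; apply: tensor_nullP => //; constructor.
Qed.

Let nullD (g h : F) : null g -> null h -> null (g + h).
Proof. by move=> gn hn; rewrite -[g]scale1r; apply: tensor_nullP. Qed.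

Let null_repr (g : F) : null (g - repr (pi g)).
Proof. by apply/tensor_piP; rewrite tensor_reprK. Qed.

Definition tensor_add (q r : T) : T := pi (repr q + repr r).
Definition tensor_opp (q : T) : T := pi (- repr q).
Definition tensor_scale (c : C) (q : T) : T := pi (c *: repr q).

Let piD (g h : F) : pi (g + h) = tensor_add (pi g) (pi h).
Proof. by apply/tensor_piP; rewrite opprD addrACA; apply: nullD. Qed.

Let piZ (c : C) (g : F) : pi (c *: g) = tensor_scale c (pi g).
Proof. by apply/tensor_piP; rewrite -scalerBr; apply: tensor_nullZ. Qed.

Let piN (g : F) : pi (- g) = tensor_opp (pi g).
Proof.
by apply/tensor_piP; rewrite -opprD -scaleN1r; apply: tensor_nullZ.
Qed.

Fact tensor_addA : associative tensor_add.
Proof.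
move=> q r t; rewrite -[q]tensor_reprK -[r]tensor_reprK -[t]tensor_reprK.
by rewrite -!piD addrA.
Qed.
Fact tensor_addC : commutative tensor_add.
Proof. by move=> q r; rewrite /tensor_add addrC. Qed.
Fact tensor_add0 : left_id (pi 0) tensor_add.
Proof. by move=> q; rewrite -[q]tensor_reprK -piD add0r. Qed.
Fact tensor_addN : left_inverse (pi 0) tensor_opp tensor_add.
Proof. by move=> q; rewrite -[q]tensor_reprK -piN -piD addNr. Qed.

HB.instance Definition _ := Choice.copy T (Quotient.quot (tensor_nullc A)).
HB.instance Definition _ := GRing.isZmodule.Build T
  tensor_addA tensor_addC tensor_add0 tensor_addN.

Fact tensor_scaleA a b v :
  tensor_scale a (tensor_scale b v) = tensor_scale (a * b) v.
Proof. by rewrite -[v]tensor_reprK -!piZ scalerA. Qed.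
Fact tensor_scale1 : left_id 1 tensor_scale.
Proof. by move=> v; rewrite -[v]tensor_reprK -!piZ scale1r. Qed.
Fact tensor_scaleDr : right_distributive tensor_scale +%R.
Proof.
move=> c u v; rewrite -[u]tensor_reprK -[v]tensor_reprK.
by rewrite -[_ + _ in LHS]piD -!piZ scalerDr piD.
Qed.
Fact tensor_scaleDl v : {morph tensor_scale^~ v : a b / a + b}.
Proof. by move=> a b; rewrite -[v]tensor_reprK -!piZ scalerDl piD. Qed.

HB.instance Definition _ := GRing.Zmodule_isLmodule.Build C T
  tensor_scaleA tensor_scale1 tensor_scaleDr tensor_scaleDl.

Lemma tensor_pi_linear c g h : pi (c *: g + h) = c *: pi g + pi h.
Proof. by rewrite piD piZ. Qed.
End TensorModule.

HB.lock Definition tensor_lift (C : numClosedFieldType) (I : choiceType)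
    (A : I -> starAlgType C) (V : lmodType C) (s : {rmorphism C -> C})
    (f : (forall i, A i) -> V) (q : tensor A) : V :=
  linext s f (tensor_repr q).

Section Tensor.
Context {C : numClosedFieldType} {I : choiceType}.
Variable A : I -> starAlgType C.
Local Notation X := (forall i, A i).
Local Notation F := {malg C[X]}.
Local Notation tensor := (tensor A).
Local Notation tensor_pi := (tensor_pi A).
Local Notation tensor_mk := (@tensor_mk C I A).
Local Notation tensor_repr := (@tensor_repr C I A).
Local Notation tensor_null := (@tensor_null C I A).
Local Notation tensor_lift := (@tensor_lift C I A _).
Implicit Types (x y : X) (s : {rmorphism C -> C}) (q r : tensor).

Lemma tensor_piE g : tensor_pi g = linext idfun tensor_mk g.
Proof. exact: (linext_uniq (s := idfun) (@tensor_pi_linear C I A)). Qed.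

Lemma tensor_mk_linear x i (c : C) (a b : A i) :
  tensor_mk (dfwith x (c *: a + b))
  = c *: tensor_mk (dfwith x a) + tensor_mk (dfwith x b).
Proof.
apply: etrans (tensor_pi_linear _ _ _).
by apply/tensor_piP; apply: tensor_nullR.
Qed.

Lemma tensor_ind (P : tensor -> Prop) :
  P 0 -> (forall c x q, P q -> P (c *: tensor_mk x + q)) -> forall q, P q.
Proof.
move=> P0 PD q; rewrite -[q]tensor_reprK tensor_piE /linext.
elim: (msupp _ : seq X) => [|k r IH]; first by rewrite big_nil.
by rewrite big_cons; apply: PD.
Qed.

Section Lift.
Context {V : lmodType C}.

Definition multilinear_for s (f : X -> V) : Prop :=
  forall x i (c : C) (a b : A i),
    f (dfwith x (c *: a + b)) = s c *: f (dfwith x a) + f (dfwith x b).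

Lemma tensor_lift_pi s f g : multilinear_for s f ->
  tensor_lift s f (tensor_pi g) = linext s f g.
Proof.
move=> mf; rewrite tensor_lift.unlock; apply/eqP; rewrite -subr_eq0; apply/eqP.
set g' := tensor_repr _.
have : tensor_null (g' - g) by apply/tensor_piP; rewrite tensor_reprK.
have l0 : linext s f 0 = 0 by rewrite /linext msupp0 big_seq_fset0.
have lB u v : linext s f (u - v) = linext s f u - linext s f v.
  by rewrite [u - v]addrC -[- v]scaleN1r linextP rmorphN1 scaleN1r addrC.
rewrite -lB; elim=> [|c u v _ uE _ vE|x i c a b] //.
  by rewrite linextP uE vE scaler0 addr0.
by rewrite lB linextP !linextU mf rmorph1 !scale1r subrr.
Qed.

Lemma tensor_lift_mk s f x : multilinear_for s f ->
  tensor_lift s f (tensor_mk x) = f x.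
Proof. by move=> mf; rewrite tensor_lift_pi // linextU rmorph1 scale1r. Qed.

Lemma tensor_liftP s f c q r : multilinear_for s f ->
  tensor_lift s f (c *: q + r) = s c *: tensor_lift s f q + tensor_lift s f r.
Proof.
move=> mf; rewrite -[q]tensor_reprK -[r]tensor_reprK -tensor_pi_linear.
by rewrite !tensor_lift_pi // linextP.
Qed.

Lemma tensor_lift0 s f : multilinear_for s f -> tensor_lift s f 0 = 0.
Proof.
by move=> /(tensor_liftP (-1) 0 0); rewrite scaler0 addr0 rmorphN1 scaleN1r addNr.
Qed.

Lemma tensor_lift_comb s (f1 f2 : X -> V) c q :
  tensor_lift s (fun x => c *: f1 x + f2 x) q
  = c *: tensor_lift s f1 q + tensor_lift s f2 q.
Proof. by rewrite !tensor_lift.unlock; exact: (@linext_comb C X V). Qed.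

Lemma eq_tensor_lift s (f1 f2 : X -> V) : f1 =1 f2 ->
  tensor_lift s f1 =1 tensor_lift s f2.
Proof. by move=> /funext ->. Qed.

Lemma tensor_lift_uniq s f (h : tensor -> V) : multilinear_for s f ->
  (forall c q r, h (c *: q + r) = s c *: h q + h r) ->
  (forall x, h (tensor_mk x) = f x) -> h =1 tensor_lift s f.
Proof.
move=> mf hP hmk q; rewrite -[q]tensor_reprK tensor_lift_pi //.
rewrite -(linext_uniq (s := s) (f := f) (h := h \o tensor_pi)) //=.
by move=> c u v; rewrite tensor_pi_linear hP.
Qed.
End Lift.

(* The multilinear form x |-> \prod_i f_i (x_i) on the families x such that
   D x, where all but finitely many factors are 1, extended by 0. *)
Section ProdForm.
Local Open Scope classical_set_scope.
Variables (D : X -> Prop) (f : forall i, A i -> C).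

Definition prod_form (x : X) : C :=
  if `[< D x >] then \big[*%R/1]_(i \in [set: I]) f (x i) else 0.

Hypothesis D_dfwith : forall x i (a : A i), D x -> D (dfwith x a).
Hypothesis D_fin : forall x, D x -> finite_set [set i | f (x i) <> 1].
Hypothesis f_lin : forall i, scalar (@f i).

Lemma prod_form_multilinear :
  @multilinear_for C^o idfun prod_form.
Proof.
move=> x i c a b; rewrite /prod_form.
have dfK (a1 a2 : A i) : dfwith (dfwith x a1) a2 = dfwith x a2.
  apply/functional_extensionality_dep => j.
  by case: dfwithP => [|k ik]; rewrite ?dfwith_in ?dfwith_out.
have De (a1 a2 : A i) : `[< D (dfwith x a1) >] = `[< D (dfwith x a2) >].
  apply/asbool_equiv_eq; split=> [/(D_dfwith a2)|/(D_dfwith a1)];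
  by rewrite dfK.
rewrite (De _ 0) (De a 0) (De b 0).
case: asboolP => [/D_fin Dfin|_]; last by rewrite scaler0 addr0.
pose S := (i |` fset_set [set j | f (dfwith x (0 : A i) j) <> 1])%fset.
have SE (a1 : A i) : \big[*%R/1]_(j \in [set: I]) f (dfwith x a1 j)
    = f a1 * \prod_(j <- (S `\ i)%fset) f (x j).
  rewrite (fsbigTE S); last first.
    move=> j; rewrite in_fset1U negb_or => /andP[ji].
    rewrite in_fset_set ?notin_setE => [/contrapT|]; last exact: Dfin.
    by rewrite !dfwith_out // eq_sym.
  rewrite (big_fsetD1 i) /= ?fset1U1 // dfwith_in; congr (_ * _).
  rewrite big_seq [RHS]big_seq; apply: eq_bigr => j.
  by rewrite in_fsetD1 => /andP[ji _]; rewrite dfwith_out 1?eq_sym.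
by rewrite !SE f_lin mulrDl -mulrA.
Qed.
End ProdForm.

Definition tensor_mul (q r : tensor) : tensor :=
  tensor_lift idfun (fun x =>
    tensor_lift idfun (fun y => tensor_mk (fun i => x i * y i)) r) q.

Definition tensor_star (q : tensor) : tensor :=
  tensor_lift Num.conj (fun x => tensor_mk (fun i => star (x i))) q.

Definition tensor_one : tensor := tensor_mk (fun i => 1).

Let dfE (op : forall i, A i -> A i) x i (a : A i) :
  (fun j => op j (dfwith x a j)) = dfwith (fun j => op j (x j)) (op i a).
Proof.
by apply/functional_extensionality_dep => j; case: dfwithP => [|k ik]; rewrite ?dfwith_in ?dfwith_out.
Qed.

Let mulr_ml x :
  multilinear_for idfun (fun y => tensor_mk (fun i => x i * y i)).
Proof.
move=> y i c a b; rewrite !(dfE (fun j => *%R (x j))) -tensor_mk_linear.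
by rewrite mulrDr scalerAr.
Qed.

Let mull_ml r : multilinear_for idfun (fun x =>
  tensor_lift idfun (fun y => tensor_mk (fun i => x i * y i)) r).
Proof.
move=> x i c a b; rewrite -tensor_lift_comb; apply: eq_tensor_lift => y.
rewrite !(dfE (fun j => *%R^~ (y j))) -tensor_mk_linear.
by rewrite mulrDl scalerAl.
Qed.

Let star_ml :
  multilinear_for Num.conj (fun x => tensor_mk (fun i => star (x i))).
Proof.
move=> x i c a b; rewrite !(dfE (fun j => @star C (A j))) starD starZ.
exact: tensor_mk_linear.
Qed.

Lemma tensor_mulE x y :
  tensor_mul (tensor_mk x) (tensor_mk y) = tensor_mk (fun i => x i * y i).
Proof. by rewrite /tensor_mul tensor_lift_mk ?tensor_lift_mk //. Qed.

Let mulPl c q q' r :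
  tensor_mul (c *: q + q') r = c *: tensor_mul q r + tensor_mul q' r.
Proof. by rewrite /tensor_mul tensor_liftP. Qed.

Let mulPr c q r r' :
  tensor_mul q (c *: r + r') = c *: tensor_mul q r + tensor_mul q r'.
Proof.
rewrite /tensor_mul -tensor_lift_comb; apply: eq_tensor_lift => x.
by rewrite tensor_liftP.
Qed.

Let mul0 q : tensor_mul 0 q = 0.
Proof. by rewrite /tensor_mul tensor_lift0. Qed.

Let muls0 q : tensor_mul q 0 = 0.
Proof.
by have := mulPr (-1) q 0 0; rewrite scaler0 addr0 scaleN1r addNr.
Qed.

Fact tensor_mulA : associative tensor_mul.
Proof.
elim/tensor_ind => [|c x q IH] r t; first by rewrite !mul0.
rewrite !mulPl IH; apply: lincong.
elim/tensor_ind: r => [|d y r IHr]; first by rewrite !(mul0, muls0).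
rewrite !(mulPl, mulPr) IHr; apply: lincong.
elim/tensor_ind: t {IHr IH} => [|e z t IHt]; first by rewrite !muls0.
rewrite !mulPr IHt !tensor_mulE; apply: lincong; congr tensor_mk.
by apply/functional_extensionality_dep => i; rewrite mulrA.
Qed.
Fact tensor_mul1 : left_id tensor_one tensor_mul.
Proof.
elim/tensor_ind => [|c x q IH]; first by rewrite muls0.
rewrite mulPr IH tensor_mulE; apply: lincong; congr tensor_mk.
by apply/functional_extensionality_dep => i; rewrite mul1r.
Qed.
Fact tensor_muls1 : right_id tensor_one tensor_mul.
Proof.
elim/tensor_ind => [|c x q IH]; first by rewrite mul0.
rewrite mulPl IH tensor_mulE; apply: lincong; congr tensor_mk.
by apply/functional_extensionality_dep => i; rewrite mulr1.
Qed.
Fact tensor_mulDl : left_distributive tensor_mul +%R.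
Proof. by move=> q r t; rewrite -[q in LHS]scale1r mulPl scale1r. Qed.
Fact tensor_mulDr : right_distributive tensor_mul +%R.
Proof. by move=> t q r; rewrite -[q in LHS]scale1r mulPr scale1r. Qed.

Fact tensor_one_neq0 : tensor_one != 0.
Proof.
have /(_ _)/cid-/all_sig[f fP] : forall i, exists f : A i -> C, scalar f /\ f 1 = 1.
  by move=> i; apply: separating_functional; exact: oner_neq0.
pose D (x : X) := finite_set [set i | f i (x i) <> 1]%classic.
have ml : @multilinear_for C^o idfun (prod_form D f).
  apply: prod_form_multilinear => // [x i a Dx|i]; last exact: (fP i).1.
  apply: (sub_finite_set (B := ([set i] `|` [set j | f j (x j) <> 1])%classic)).
    move=> j /=; have [->|ji] := eqVneq j i; first by left.
    by rewrite dfwith_out 1?eq_sym //; right.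
  by rewrite finite_setU; split.
apply/eqP => /(congr1 (@tensor_lift.body C I A C^o idfun (prod_form D f))).
rewrite tensor_lift_mk // tensor_lift0 // /prod_form ifT.
  by rewrite fsbig1 => [/eqP|i _]; rewrite ?oner_eq0 ?(fP i).2.
apply/asboolP; rewrite /D (_ : mkset _ = set0) //.
by rewrite -subset0 => i /=; rewrite (fP i).2.
Qed.

HB.instance Definition _ := GRing.Zmodule_isNzRing.Build tensor
  tensor_mulA tensor_mul1 tensor_muls1 tensor_mulDl tensor_mulDr
  tensor_one_neq0.

Lemma tensor_starE x : tensor_star (tensor_mk x) = tensor_mk (fun i => star (x i)).
Proof. by rewrite /tensor_star tensor_lift_mk. Qed.

Let starP c q r :
  tensor_star (c *: q + r) = c^* *: tensor_star q + tensor_star r.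
Proof. by rewrite /tensor_star tensor_liftP. Qed.

Let star0' : tensor_star 0 = 0.
Proof. by rewrite /tensor_star tensor_lift0. Qed.

Fact tensor_scalerAl (c : C) (q r : tensor) : c *: (q * r) = (c *: q) * r.
Proof. by have := mulPl c q 0 r; rewrite mul0 !addr0 => <-. Qed.
Fact tensor_scalerAr (c : C) (q r : tensor) : c *: (q * r) = q * (c *: r).
Proof. by have := mulPr c q r 0; rewrite muls0 !addr0 => <-. Qed.
HB.instance Definition _ := GRing.Lmodule_isLalgebra.Build C tensor
  tensor_scalerAl.
HB.instance Definition _ := GRing.Lalgebra_isAlgebra.Build C tensor
  tensor_scalerAr.

Fact tensor_starD : {morph tensor_star : q r / q + r}.
Proof. by move=> q r; rewrite -[q in LHS]scale1r starP rmorph1 scale1r. Qed.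
Fact tensor_starZ (c : C) (q : tensor) :
  tensor_star (c *: q) = c^* *: tensor_star q.
Proof. by have := starP c q 0; rewrite star0' !addr0. Qed.
Fact tensor_starM (q r : tensor) :
  tensor_star (q * r) = tensor_star r * tensor_star q.
Proof.
elim/tensor_ind: q => [|c x q IH]; first by rewrite mul0r star0' mulr0.
rewrite mulrDl !starP -tensor_scalerAl starP IH mulrDr -tensor_scalerAr.
apply: lincong.
elim/tensor_ind: r {IH} => [|d y r IHr]; first by rewrite mulr0 star0' mul0r.
rewrite mulrDr !starP -tensor_scalerAr starP IHr mulrDl -tensor_scalerAl.
apply: lincong; rewrite /GRing.mul /= !tensor_starE !tensor_mulE.
rewrite tensor_starE; congr tensor_mk.
by apply/functional_extensionality_dep => i; rewrite starM.
Qed.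
Fact tensor_starK : involutive tensor_star.
Proof.
elim/tensor_ind => [|c x q IH]; first by rewrite !star0'.
rewrite !starP IH conjCK !tensor_starE; apply: lincong; congr tensor_mk.
by apply/functional_extensionality_dep => i; rewrite starK.
Qed.

HB.instance Definition _ := isStarAlgebra.Build C tensor
  tensor_starD tensor_starZ tensor_starM
  tensor_starK.

Lemma tensor_mkM x y :
  tensor_mk x * tensor_mk y = tensor_mk (fun i => x i * y i).
Proof. exact: tensor_mulE. Qed.

Lemma tensor_mk1 : 1 = tensor_mk (fun i => 1).
Proof. by []. Qed.

Lemma star_tensor_mk x : star (tensor_mk x) = tensor_mk (fun i => star (x i)).
Proof. exact: tensor_starE. Qed.
End Tensor.

HB.mixin Record hasInvolution T of Choice T := {
  invol : T -> T;
  involK : involutive invol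
}.

#[short(type="invChoiceType")]
HB.structure Definition InvChoice := {T of Choice T & hasInvolution T}.

(* The free unital algebra over C on the letters L, with the words in L as
   basis; the involution of L extends to words by reversal. *)
Definition free_alg (C : numClosedFieldType) (L : invChoiceType) : Type :=
  {malg C[{fmonom L}]}.

HB.lock Definition word (C : numClosedFieldType) (L : invChoiceType)
    (w : seq L) : free_alg C L := << FMonom w >>.

HB.lock Definition free_add (C : numClosedFieldType) (L : invChoiceType)
    (x y : free_alg C L) : free_alg C L := (x : {malg C[{fmonom L}]}) + y.

HB.lock Definition free_opp (C : numClosedFieldType) (L : invChoiceType)
    (x : free_alg C L) : free_alg C L := - (x : {malg C[{fmonom L}]}).

HB.lock Definition free_mul (C : numClosedFieldType) (L : invChoiceType)
    (x y : free_alg C L) : free_alg C L := (x : {malg C[{fmonom L}]}) * y.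

HB.lock Definition free_scale (C : numClosedFieldType) (L : invChoiceType)
    (c : C) (x : free_alg C L) : free_alg C L :=
  c *: (x : {malg C[{fmonom L}]}).

(* The semilinear extension of a map f defined on words. *)
HB.lock Definition word_lift (C : numClosedFieldType) (L : invChoiceType)
    (V : lmodType C) (s : {rmorphism C -> C}) (f : seq L -> V)
    (x : free_alg C L) : V :=
  linext s (fun m : {fmonom L} => f m) (x : {malg C[{fmonom L}]}).

Arguments word {C L} w.

Section FreeAlgebra.
Context {C : numClosedFieldType}.
Local Notation free_alg := (free_alg C).

Section FreeAlgebraStar.
Context {L : invChoiceType}.
Local Notation M := {malg C[{fmonom L}]}.
Local Notation word := (@word C L).
Local Notation free_add := (@free_add C L).
Local Notation free_opp := (@free_opp C L).
Local Notation free_mul := (@free_mul C L).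
Local Notation free_scale := (@free_scale C L).

Fact free_addA : associative free_add.
Proof. by move=> x y z; rewrite free_add.unlock (@addrA M). Qed.
Fact free_addC : commutative free_add.
Proof. by move=> x y; rewrite free_add.unlock (@addrC M). Qed.
Fact free_add0 : left_id (0 : M) free_add.
Proof. by move=> x; rewrite free_add.unlock (@add0r M). Qed.
Fact free_addN : left_inverse (0 : M) free_opp free_add.
Proof. by move=> x; rewrite free_add.unlock free_opp.unlock (@addNr M). Qed.

HB.instance Definition _ := Choice.copy (free_alg L) M.
HB.instance Definition _ := GRing.isZmodule.Build (free_alg L)
  free_addA free_addC free_add0 free_addN.

Let addE (x y : free_alg L) : x + y = (x : M) + y.
Proof. by rewrite [LHS](_ : _ = free_add x y) // free_add.unlock. Qed.

Fact free_mulA : associative free_mul.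
Proof. by move=> x y z; rewrite free_mul.unlock (@mulrA M). Qed.
Fact free_mul1 : left_id (word [::]) free_mul.
Proof.
move=> x; rewrite free_mul.unlock word.unlock.
rewrite (_ : FMonom [::] = mone); first exact: (@mul1r M).
by apply: val_inj; rewrite /= fm1.
Qed.
Fact free_muls1 : right_id (word [::]) free_mul.
Proof.
move=> x; rewrite free_mul.unlock word.unlock.
rewrite (_ : FMonom [::] = mone); first exact: (@mulr1 M).
by apply: val_inj; rewrite /= fm1.
Qed.
Fact free_mulDl : left_distributive free_mul +%R.
Proof. by move=> x y z; rewrite !addE free_mul.unlock (@mulrDl M). Qed.
Fact free_mulDr : right_distributive free_mul +%R.
Proof. by move=> x y z; rewrite !addE free_mul.unlock (@mulrDr M). Qed.
Fact free_one_neq0 : word [::] != 0.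
Proof.
rewrite word.unlock; apply: contra_neq (oner_neq0 C) => w0.
have := congr1 (fun x : M => x@_(FMonom [::])) w0.
by rewrite mcoeffUU (mcoeff0 (K := {fmonom L}) (G := C)).
Qed.

HB.instance Definition _ := GRing.Zmodule_isNzRing.Build (free_alg L)
  free_mulA free_mul1 free_muls1 free_mulDl free_mulDr free_one_neq0.

Fact free_scaleA a b v : free_scale a (free_scale b v) = free_scale (a * b) v.
Proof. by rewrite free_scale.unlock (@scalerA C M). Qed.
Fact free_scale1 : left_id 1 free_scale.
Proof. by move=> x; rewrite free_scale.unlock (@scale1r C M). Qed.
Fact free_scaleDr : right_distributive free_scale +%R.
Proof. by move=> c x y; rewrite !addE free_scale.unlock (@scalerDr C M). Qed.
Fact free_scaleDl v : {morph free_scale^~ v : a b / a + b}.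
Proof. by move=> a b; rewrite addE free_scale.unlock (@scalerDl C M). Qed.

HB.instance Definition _ := GRing.Zmodule_isLmodule.Build C (free_alg L)
  free_scaleA free_scale1 free_scaleDr free_scaleDl.

Let scaleE c (x : free_alg L) : c *: x = c *: (x : M).
Proof. by rewrite [LHS](_ : _ = free_scale c x) // free_scale.unlock. Qed.

Let mulE (x y : free_alg L) : x * y = (x : M) * y.
Proof. by rewrite [LHS](_ : _ = free_mul x y) // free_mul.unlock. Qed.

Fact free_scalerAl (c : C) (x y : free_alg L) : c *: (x * y) = (c *: x) * y.
Proof. by rewrite !scaleE !mulE (@scalerAl C M). Qed.

Fact free_scalerAr (c : C) (x y : free_alg L) : c *: (x * y) = x * (c *: y).
Proof.
rewrite !scaleE !mulE; apply/malgP => k; rewrite mcoeffZ.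
rewrite [X in _ * X](mcoeffMl (x : M) y).
rewrite [RHS](mcoeffMlw k (fsubset_refl (msupp (x : M)))
  (msuppZ_le c (y : M))).
rewrite mulr_sumr; apply: eq_bigr => k1 _; rewrite mulr_sumr.
by apply: eq_bigr => k2 _; rewrite mcoeffZ mulrnAr mulrCA.
Qed.

HB.instance Definition _ := GRing.Lmodule_isLalgebra.Build C (free_alg L)
  free_scalerAl.
HB.instance Definition _ := GRing.Lalgebra_isAlgebra.Build C (free_alg L)
  free_scalerAr.

Definition letter (a : L) : free_alg L := word [:: a].

Lemma word1 : 1 = word [::] :> free_alg L.
Proof. by []. Qed.

Lemma wordM v w : word v * word w = word (v ++ w).
Proof.
rewrite mulE word.unlock; apply: etrans (fgmulUU _ _ _ _) _; rewrite mulr1.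
by congr (<< _ >>); apply: val_inj; rewrite /= fmM.
Qed.

Lemma wordE w : word w = \prod_(a <- w) letter a.
Proof.
elim: w => [|a w IH]; first by rewrite big_nil word1.
by rewrite big_cons -IH wordM.
Qed.

Lemma free_ind (P : free_alg L -> Prop) :
  P 0 -> (forall c w x, P x -> P (c *: word w + x)) -> forall x, P x.
Proof.
move=> P0 PD x; rewrite [x](@monalgE {fmonom L} C).
elim: (msupp (x : M) : seq {fmonom L}) => [|m r IH]; first by rewrite big_nil.
rewrite big_cons; have := PD (x : M)@_m m _ IH.
rewrite addE scaleE word.unlock.
rewrite (_ : (x : M)@_m *: << FMonom m >> = << (x : M)@_m *g m >>) //.
by apply/malgP => k; rewrite mcoeffZ !mcoeffU fmK mulrnAr mulr1.
Qed.

Section Semilinear.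
Context {V : lmodType C}.
Implicit Types (s : {rmorphism C -> C}) (f : seq L -> V) (x y : free_alg L).
Local Notation word_lift := (@word_lift C L V).

Lemma word_lift_word s f w : word_lift s f (word w) = f w.
Proof.
by rewrite word_lift.unlock word.unlock linextU rmorph1 scale1r.
Qed.

Lemma word_liftP s f c x y :
  word_lift s f (c *: x + y) = s c *: word_lift s f x + word_lift s f y.
Proof. by rewrite addE scaleE word_lift.unlock linextP. Qed.

Lemma word_lift0 s f : word_lift s f 0 = 0.
Proof.
by have := word_liftP s f (-1) 0 0; rewrite scaler0 addr0 rmorphN1 scaleN1r addNr.
Qed.
End Semilinear.

Definition free_star (x : free_alg L) : free_alg L :=
  word_lift Num.conj (fun w => word (rev (map invol w))) x.

Let starP c x y :
  free_star (c *: x + y) = c^* *: free_star x + free_star y.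
Proof. exact: word_liftP. Qed.

Let star0' : free_star 0 = 0.
Proof. exact: word_lift0. Qed.

Lemma free_star_word w : free_star (word w) = word (rev (map invol w)).
Proof. exact: word_lift_word. Qed.

Fact free_starD : {morph free_star : x y / x + y}.
Proof. by move=> x y; rewrite -[x in LHS]scale1r starP rmorph1 scale1r. Qed.
Fact free_starZ (c : C) (x : free_alg L) :
  free_star (c *: x) = c^* *: free_star x.
Proof. by have := starP c x 0; rewrite star0' !addr0. Qed.
Fact free_starM (x y : free_alg L) :
  free_star (x * y) = free_star y * free_star x.
Proof.
elim/free_ind: x => [|c v x IH]; first by rewrite mul0r star0' mulr0.
rewrite mulrDl -(scalerAl c (word v) y) !starP IH mulrDr.
rewrite -(scalerAr c^* (free_star y) (free_star (word v))).
apply: lincong.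
elim/free_ind: y {IH} => [|d w y IH]; first by rewrite mulr0 star0' mul0r.
rewrite mulrDr -(scalerAr d (word v) (word w)) !starP IH mulrDl.
rewrite -(scalerAl d^* (free_star (word w)) (free_star (word v))).
by rewrite wordM !free_star_word wordM map_cat rev_cat.
Qed.
Fact free_starK : involutive free_star.
Proof.
elim/free_ind => [|c w x IH]; first by rewrite !star0'.
rewrite !starP IH conjCK !free_star_word map_rev revK -map_comp.
by rewrite (eq_map involK) map_id.
Qed.

HB.instance Definition _ := isStarAlgebra.Build C (free_alg L)
  free_starD free_starZ free_starM free_starK.

Lemma star_letter (a : L) : star (letter a) = letter (invol a).
Proof. exact: free_star_word. Qed.
End FreeAlgebraStar.

(* The unital homomorphism extending f, unique by [free_lift_uniq]. *)
Section FreeLift.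
Context {L : invChoiceType} {B : algType C}.
Implicit Types f : L -> B.

Definition free_lift f : free_alg L -> B :=
  word_lift idfun (fun w => \prod_(a <- w) f a).

Lemma free_lift_word f w : free_lift f (word w) = \prod_(a <- w) f a.
Proof. exact: word_lift_word. Qed.

Lemma free_lift_letter f a : free_lift f (letter a) = f a.
Proof. by rewrite free_lift_word big_seq1. Qed.

Lemma free_lift_linear f : linear (free_lift f).
Proof. exact: word_liftP. Qed.

Lemma free_lift1 f : free_lift f 1 = 1.
Proof. by rewrite word1 free_lift_word big_nil. Qed.

Lemma free_liftM f : {morph free_lift f : x y / x * y}.
Proof.
have l0 : free_lift f 0 = 0 by exact: word_lift0.
move=> x y; elim/(@free_ind L): x => [|c v x IH]; first by rewrite !(mul0r, l0).
rewrite mulrDl -(scalerAl c (word v) y) !free_lift_linear IH mulrDl.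
rewrite -(scalerAl c (free_lift f (word v)) (free_lift f y)).
apply: lincong.
elim/(@free_ind L): y {IH} => [|d w y IH]; first by rewrite !(mulr0, l0).
rewrite mulrDr -(scalerAr d (word v) (word w)) !free_lift_linear IH mulrDr.
rewrite -(scalerAr d (free_lift f (word v)) (free_lift f (word w))).
by rewrite wordM !free_lift_word big_cat.
Qed.

Lemma free_lift_uniq f (h : free_alg L -> B) :
  linear h -> {morph h : x y / x * y} -> h 1 = 1 ->
  (forall a, h (letter a) = f a) -> h =1 free_lift f.
Proof.
move=> hL hM h1 hf; elim/(@free_ind L) => [|c w x IH].
  have := hL (-1) 0 0; rewrite scaler0 addr0 scaleN1r addNr => ->.
  by rewrite [RHS]word_lift0.
rewrite hL free_lift_linear IH; apply: lincong.
rewrite free_lift_word wordE; elim: w => [|a w IHw]; rewrite ?big_nil //.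
by rewrite !big_cons hM hf IHw.
Qed.
End FreeLift.

Lemma free_lift_star (L : invChoiceType) (B : starAlgType C) (f : L -> B) :
  (forall a, f (invol a) = star (f a)) ->
  is_starhom (free_lift f : free_alg L -> B).
Proof.
move=> fs; split; [exact: free_lift_linear|exact: free_liftM|exact: free_lift1|].
elim/(@free_ind L) => [|c w x IH].
  have l0 : free_lift f 0 = 0 by exact: word_lift0.
  by rewrite star0 !l0 star0.
rewrite starD starZ !free_lift_linear IH starD starZ; apply: lincong.
rewrite [star _]free_star_word !free_lift_word.
elim: w => [|a w IHw]; first by rewrite !big_nil star1.
by rewrite /= rev_cons big_rcons /= big_cons starM IHw fs.
Qed.
End FreeAlgebra.

Definition is_alghom (C : numClosedFieldType) (A B : algType C) (h : A -> B) :=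
  [/\ linear h, {morph h : x y / x * y} & h 1 = 1].

Lemma free_lift_hom (C : numClosedFieldType) (L : invChoiceType)
    (B : algType C) (f : L -> B) : is_alghom (free_lift f).
Proof.
split; [exact: free_lift_linear|exact: free_liftM|exact: free_lift1].
Qed.

Lemma free_hom_ext (C : numClosedFieldType) (L : invChoiceType)
    (B : algType C) (h h' : free_alg C L -> B) :
  is_alghom h -> is_alghom h' -> (forall a, h (letter a) = h' (letter a)) ->
  h =1 h'.
Proof.
move=> [hL hM h1] [hL' hM' h1'] hh' x.
by rewrite (free_lift_uniq hL hM h1 hh') (free_lift_uniq hL' hM' h1' (frefl _)).
Qed.

Lemma is_alghom_comp (C : numClosedFieldType) (A B D : algType C)
    (h : A -> B) (g : B -> D) :
  is_alghom h -> is_alghom g -> is_alghom (g \o h).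
Proof.
move=> [hL hM h1] [gL gM g1]; split=> [c x y|x y|] /=; first by rewrite hL gL.
  by rewrite hM gM.
by rewrite h1.
Qed.

(* The letters a (as (a, false)) and a^* (as (a, true)), a in G. *)
Definition letters (G : choiceType) : Type := (G * bool)%type.
HB.instance Definition _ (G : choiceType) :=
  Choice.copy (letters G) (G * bool)%type.
Fact letters_involK (G : choiceType) :
  involutive (fun a : letters G => (a.1, ~~ a.2) : letters G).
Proof. by case=> a b /=; rewrite negbK. Qed.
HB.instance Definition _ (G : choiceType) :=
  hasInvolution.Build (letters G) (@letters_involK G).

(* L with an additional self-adjoint letter t := None;
   see [tletters_universal]. *)
Definition tletters (L : invChoiceType) : Type := option L.
HB.instance Definition _ (L : invChoiceType) :=
  Choice.copy (tletters L) (option L).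
Fact tletters_involK (L : invChoiceType) :
  involutive (fun a : tletters L => omap invol a : tletters L).
Proof. by case=> //= a; rewrite involK. Qed.
HB.instance Definition _ (L : invChoiceType) :=
  hasInvolution.Build (tletters L) (@tletters_involK L).

Definition sum_letters (L : nat -> invChoiceType) : Type := {l : nat & L l}.
HB.instance Definition _ (L : nat -> invChoiceType) :=
  Choice.copy (sum_letters L) {l : nat & L l}.
Fact sum_letters_involK (L : nat -> invChoiceType) : involutive
  (fun a : sum_letters L => Tagged L (invol (tagged a)) : sum_letters L).
Proof. by case=> l a /=; rewrite involK. Qed.
HB.instance Definition _ (L : nat -> invChoiceType) :=
  hasInvolution.Build (sum_letters L) (@sum_letters_involK L).

Section BooleanExtension.
Context {C : numClosedFieldType} {L : invChoiceType}.
Implicit Types phi : free_alg C L -> C.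

Definition tvar : free_alg C (tletters L) := letter (None : tletters L).

Definition tincl : free_alg C L -> free_alg C (tletters L) :=
  free_lift (fun a => letter (Some a : tletters L)).

(* phi~ of a word: the product of the phi (w_i) over the blocks w_i between
   consecutive occurrences of t; v is the part of the current block already
   read.  Empty blocks are harmless as phi 1 = 1. *)
Fixpoint boolean_word phi (v : seq L) (w : seq (tletters L)) : C :=
  match w with
  | [::] => phi (word v)
  | Some a :: w' => boolean_word phi (rcons v a) w'
  | None :: w' => phi (word v) * boolean_word phi [::] w'
  end.

Definition boolean_ext phi : free_alg C (tletters L) -> C :=
  @word_lift C (tletters L) C^o idfun (boolean_word phi [::]).

Lemma boolean_ext_scalar phi : scalar (boolean_ext phi).
Proof. by move=> c x y; rewrite /boolean_ext word_liftP. Qed.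

(* free_alg C (tletters L) is the free product of free_alg C L and C[t]. *)
Lemma tletters_universal (B : algType C) (h : free_alg C L -> B) (b : B) :
  is_alghom h ->
  exists2 H : free_alg C (tletters L) -> B,
    [/\ is_alghom H, forall x, H (tincl x) = h x & H tvar = b] &
    forall H', is_alghom H' -> (forall x, H' (tincl x) = h x) ->
      H' tvar = b -> H' =1 H.
Proof.
move=> hh; pose f (a : tletters L) := if a is Some a' then h (letter a') else b.
have fh := free_lift_hom f.
exists (free_lift f); [split=> //; last exact: free_lift_letter|].
  apply: (free_hom_ext (is_alghom_comp (free_lift_hom _) fh) hh) => a.
  by rewrite /= !free_lift_letter.
move=> H' H'h H'i H't; apply: (free_hom_ext H'h fh) => -[a|].
  rewrite free_lift_letter -[RHS](H'i (letter a)); congr (H' _).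
  by rewrite /tincl free_lift_letter.
by rewrite free_lift_letter.
Qed.

Lemma tincl_word w : tincl (word w) = word (map Some w : seq (tletters L)).
Proof. by rewrite /tincl free_lift_word wordE big_map. Qed.

Lemma tvarX r : tvar ^+ r = word (nseq r None : seq (tletters L)).
Proof. by elim: r => [|r IH]; rewrite ?expr0 ?word1 // exprS IH wordM. Qed.

Section Unital.
Variable phi : free_alg C L -> C.
Hypothesis phi1 : phi 1 = 1.

Let bw_some v w u :
  boolean_word phi v (map Some w ++ u) = boolean_word phi (v ++ w) u.
Proof.
by elim: w v => [|a w IH] v /=; rewrite ?cats0 // IH cat_rcons.
Qed.

Let bw_t0 r u :
  boolean_word phi [::] (nseq r None ++ u) = boolean_word phi [::] u.
Proof. by elim: r => //= r ->; rewrite -word1 phi1 mul1r. Qed.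

Let bw_t r v u : (0 < r)%N ->
  boolean_word phi v (nseq r None ++ u)
  = phi (word v) * boolean_word phi [::] u.
Proof. by case: r => //= r _; rewrite bw_t0. Qed.

Lemma boolean_ext_tX r : boolean_ext phi (tvar ^+ r) = 1.
Proof.
by rewrite tvarX /boolean_ext word_lift_word -[nseq _ _]cats0 bw_t0 /= -word1.
Qed.

Lemma boolean_ext1 : boolean_ext phi 1 = 1.
Proof. exact: (boolean_ext_tX 0). Qed.

Lemma boolean_extE r0 (s : seq (seq L * nat)) w r :
  all (fun p => 0 < p.2)%N s ->
  boolean_ext phi (tvar ^+ r0
    * (\prod_(p <- s) (tincl (word p.1) * tvar ^+ p.2))
    * (tincl (word w) * tvar ^+ r))
  = \prod_(p <- s) phi (word p.1) * phi (word w).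
Proof.
move=> sP.
have prodE : \prod_(p <- s) (tincl (word p.1) * tvar ^+ p.2)
    = word (flatten [seq map Some p.1 ++ nseq p.2 None | p <- s]
        : seq (tletters L)).
  elim: s {sP} => [|p s IH]; first by rewrite big_nil word1.
  by rewrite big_cons IH tincl_word tvarX !wordM.
rewrite prodE tincl_word !tvarX !wordM /boolean_ext word_lift_word -!catA bw_t0.
elim: s sP {prodE} => [_|p s IH /= /andP[p2 sP]].
  rewrite big_nil mul1r /= bw_some; case: r => [|r] //.
  by rewrite -[nseq _ _]cats0 bw_t //= -word1 phi1 mulr1.
by rewrite big_cons -mulrA -!catA bw_some bw_t // IH.
Qed.
End Unital.
End BooleanExtension.

(* A_l = alg l is generated by G l; the indices l : nat start at 0. *)
Section CondFree.
Context {C : numClosedFieldType}.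
Variable G : nat -> choiceType.

Definition alg (l : nat) := free_alg C (letters (G l)).
Definition talg (l : nat) := free_alg C (tletters (letters (G l))).
Definition gletters : Type := sum_letters (fun l => letters (G l)).
HB.instance Definition _ := InvChoice.on gletters.
Definition free_prod := free_alg C gletters.

HB.instance Definition _ l := StarAlgebra.on (alg l).
HB.instance Definition _ l := StarAlgebra.on (talg l).
HB.instance Definition _ := StarAlgebra.on free_prod.

Definition fincl (l : nat) : alg l -> free_prod :=
  free_lift (fun a : letters (G l) => letter (existT _ l a : gletters)).

(* free_prod is the free product of the algebras alg l. *)
Lemma free_prod_universal (B : algType C) (h : forall l, alg l -> B) :
  (forall l, is_alghom (@h l)) ->
  exists2 H : free_prod -> B,
    is_alghom H /\ (forall l (x : alg l), H (fincl x) = h l x) &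
    forall H', is_alghom H' -> (forall l (x : alg l), H' (fincl x) = h l x) ->
      H' =1 H.
Proof.
move=> hh; pose f (a : gletters) := h (tag a) (letter (tagged a)).
have fh := free_lift_hom f.
exists (free_lift f).
  split=> // l.
  apply: (free_hom_ext (is_alghom_comp (free_lift_hom _) fh) (hh l)) => a.
  by rewrite /= !free_lift_letter.
move=> H' H'h H'i; apply: (free_hom_ext H'h fh) => -[l a].
rewrite free_lift_letter -[RHS](H'i l (letter a)); congr (H' _).
by rewrite /fincl free_lift_letter.
Qed.

Definition tensor_pow (m l : nat) :=
  tensor (fun _ : 'I_m => talg l : starAlgType C).
HB.instance Definition _ m l := StarAlgebra.on (tensor_pow m l).

Definition full_tensor (m : nat) :=
  tensor (fun l : nat => tensor_pow m l : starAlgType C).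
HB.instance Definition _ m := StarAlgebra.on (full_tensor m).

Definition pow_mk m l (x : 'I_m -> talg l) : tensor_pow m l :=
  @tensor_mk C 'I_m (fun _ => talg l) x.
Definition full_mk m (x : forall l, tensor_pow m l) : full_tensor m :=
  @tensor_mk C nat (fun l => tensor_pow m l) x.

(* The elementary tensors spanning A~^(m) inside the full tensor product. *)
Definition admissible m (x : forall l, tensor_pow m l) : Prop :=
  finite_set [set l | ~ exists r : 'I_m -> nat,
    x l = pow_mk (fun i => tvar ^+ r i)]%classic.

Inductive tilde_alg m : full_tensor m -> Prop :=
| tilde_alg0 : tilde_alg 0
| tilde_algP c (x : forall l, tensor_pow m l) q :
    admissible x -> tilde_alg q -> tilde_alg (c *: full_mk x + q).

Definition Phi_site m l (phi psi : alg l -> C) : tensor_pow m l -> C :=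
  @tensor_lift C 'I_m (fun _ => talg l) C^o idfun
    (fun x => \prod_(i < m) boolean_ext (if i == 0%N :> nat then phi else psi) (x i)).

(* Phi~^(m), extended by 0 to the elementary tensors that are not admissible;
   see [Phi_tilde_mk] for its values on A~^(m). *)
Definition Phi_tilde m (phi psi : forall l, alg l -> C) : full_tensor m -> C :=
  @tensor_lift C nat (fun l => tensor_pow m l) C^o idfun
    (prod_form (@admissible m) (fun l => Phi_site (phi l) (psi l))).

(* With 1 <= k as in t_[k,m] and i_{k,m}: i : 'I_m is the (i+1)-st factor. *)
Definition t_from m k l : tensor_pow m l :=
  pow_mk (fun i : 'I_m => if (i.+1 < k)%N then 1 else tvar).

Definition i_at m k l (x : talg l) : tensor_pow m l :=
  if (k <= m)%N then pow_mk (fun i : 'I_m => if i.+1 == k then x else 1)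
  else 0.

Definition j_gen m l (a : letters (G l)) : full_tensor m :=
  let x : talg l := tincl (letter a) in
  \sum_(1 <= k < m.+1)
    full_mk (dfwith (t_from m k) (i_at m k x - i_at m k.+1 x)).

Definition j_hom m : free_prod -> full_tensor m := 
  free_lift (fun a : gletters => j_gen m (tagged a)).

Definition alternating n (k : 'I_n -> nat) : Prop :=
  forall i i' : 'I_n, i' = i.+1 :> nat -> k i <> k i'.

Definition is_cfree_product (phi psi : forall l, alg l -> C)
    (Phi : free_prod -> C) : Prop :=
  is_state Phi /\
  forall n (k : 'I_n -> nat) (a : forall i, alg (k i)),
    alternating k -> (forall i, psi (k i) (a i) = 0) ->
    Phi (\prod_(i < n) fincl (a i)) = \prod_(i < n) phi (k i) (a i).

Section Facts.
Variables (m : nat) (phi psi : forall l, alg l -> C).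
Arguments phi : clear implicits.
Arguments psi : clear implicits.
Hypothesis phi_state : forall l, is_state (phi l).
Hypothesis psi_state : forall l, is_state (psi l).

Let site_ml l : @multilinear_for C 'I_m (fun _ => talg l) C^o idfun (fun x =>
  \prod_(i < m) boolean_ext (if i == 0%N :> nat then phi l else psi l) (x i)).
Proof.
move=> x i c a b; pose f (j : 'I_m) := if j == 0%N :> nat then phi l else psi l.
have E a' : \prod_(j < m) boolean_ext (f j) (@dfwith _ (fun=> talg l : Type) x i a' j)
    = boolean_ext (f i) a' * \prod_(j < m | j != i) boolean_ext (f j) (x j).
  rewrite (bigD1 i) // dfwith_in; congr (_ * _).
  by apply: eq_bigr => j ji; rewrite dfwith_out // eq_sym.
by rewrite !E boolean_ext_scalar mulrDl -mulrA.
Qed.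

Lemma Phi_site_mk l (x : 'I_m -> talg l) :
  Phi_site (phi l) (psi l) (pow_mk x) =
  \prod_(i < m) boolean_ext (if i == 0%N :> nat then phi l else psi l) (x i).
Proof. exact: (@tensor_lift_mk C 'I_m (fun _ => talg l) C^o idfun _ x (@site_ml l)). Qed.

Lemma Phi_site_scalar l :
  scalar (Phi_site (phi l) (psi l) : tensor_pow m l -> C).
Proof. by move=> c q r; exact: (@tensor_liftP C 'I_m (fun _ => talg l) C^o idfun _ c q r (@site_ml l)). Qed.

Let site_t l (r : 'I_m -> nat) :
  Phi_site (phi l) (psi l) (pow_mk (fun i => tvar ^+ r i)) = 1.
Proof.
rewrite Phi_site_mk big1 // => i _; apply: boolean_ext_tX.
by case: ifP => _; [case: (phi_state l)|case: (psi_state l)].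
Qed.

Lemma admissible_dfwith (x : forall l, tensor_pow m l) l (a : tensor_pow m l) :
  admissible x -> admissible (dfwith x a).
Proof.
move=> xP; apply: (@sub_finite_set _ _ ([set l] `|`
  [set l | ~ exists r : 'I_m -> nat, x l = pow_mk (fun i => tvar ^+ r i)])%classic).
  move=> l' /=; have [->|ll'] := eqVneq l' l; first by left.
  by rewrite dfwith_out 1?eq_sym //; right.
by rewrite finite_setU; split.
Qed.

Let Phi_ml : @multilinear_for C nat (fun l => tensor_pow m l) C^o idfun
  (prod_form (@admissible m) (fun l => Phi_site (phi l) (psi l))).
Proof.
apply: prod_form_multilinear; last exact: Phi_site_scalar.
  exact: admissible_dfwith.
move=> x; apply: sub_finite_set => l /= nx [r xr]; apply: nx.
by rewrite xr site_t.
Qed.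

Lemma Phi_tilde_mk (x : forall l, tensor_pow m l) : admissible x ->
  Phi_tilde phi psi (full_mk x)
  = \big[*%R/1]_(l \in [set: nat]%classic) Phi_site (phi l) (psi l) (x l).
Proof.
move=> xP; apply: etrans (@tensor_lift_mk C nat (fun l => tensor_pow m l) C^o idfun _ x Phi_ml) _.
by rewrite /prod_form; case: asboolP.
Qed.

Lemma Phi_tilde_scalar : scalar (@Phi_tilde m phi psi).
Proof. by move=> c q r; exact: (@tensor_liftP C nat (fun l => tensor_pow m l) C^o idfun _ c q r Phi_ml). Qed.
End Facts.

Section Hom.
Variable m : nat.

Let full_mkM (x y : forall l, tensor_pow m l) :
  full_mk x * full_mk y = full_mk (fun l => x l * y l).
Proof. exact: tensor_mkM. Qed.

Let pow_mkM l (x y : 'I_m -> talg l) :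
  pow_mk x * pow_mk y = pow_mk (fun i => x i * y i).
Proof. exact: tensor_mkM. Qed.

Lemma t_fromE k l :
  t_from m k l = pow_mk (fun i : 'I_m => tvar ^+ (k <= i.+1)%N).
Proof.
rewrite /t_from; congr pow_mk; apply/funext => i.
by rewrite (leqNgt k); case: (_ < k)%N; rewrite ?expr0 ?expr1.
Qed.

Lemma tilde_algD (q r : full_tensor m) :
  tilde_alg q -> tilde_alg r -> tilde_alg (q + r).
Proof.
elim=> [|c x q' xP _ IH] rP; first by rewrite add0r.
by rewrite -addrA; apply: tilde_algP => //; apply: IH.
Qed.

Lemma tilde_algZ c (q : full_tensor m) : tilde_alg q -> tilde_alg (c *: q).
Proof.
elim=> [|d x q' xP _ IH]; first by rewrite scaler0; exact: tilde_alg0.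
by rewrite scalerDr scalerA; apply: tilde_algP.
Qed.

Lemma tilde_alg_mk (x : forall l, tensor_pow m l) :
  admissible x -> tilde_alg (full_mk x).
Proof.
move=> xP; rewrite -[full_mk x]scale1r -[_ *: _]addr0.
by apply: tilde_algP => //; exact: tilde_alg0.
Qed.

Lemma admissibleM (x y : forall l, tensor_pow m l) :
  admissible x -> admissible y -> admissible (fun l => x l * y l).
Proof.
move=> xP yP; have := xP; rewrite /admissible => xP'.
have /sub_finite_set : finite_set (
    [set l | ~ exists r : 'I_m -> nat, x l = pow_mk (fun i => tvar ^+ r i)] `|`
    [set l | ~ exists r : 'I_m -> nat, y l = pow_mk (fun i => tvar ^+ r i)])%classic.
  by rewrite finite_setU; split.
apply=> l /= nxy; apply: contrapT => /not_orP[/contrapT[r xr] /contrapT[s ys]].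
apply: nxy; exists (fun i => r i + s i)%N; rewrite xr ys pow_mkM.
by congr pow_mk; apply/funext => i; rewrite exprD.
Qed.

Lemma tilde_algM (q r : full_tensor m) :
  tilde_alg q -> tilde_alg r -> tilde_alg (q * r).
Proof.
move=> qP rP; elim: qP => [|c x q' xP _ IH].
  by rewrite mul0r; exact: tilde_alg0.
rewrite mulrDl; apply: tilde_algD IH; rewrite -scalerAl; apply: tilde_algZ.
elim: rP => [|d y r' yP _ IHr]; first by rewrite mulr0; exact: tilde_alg0.
rewrite mulrDr; apply: tilde_algD IHr; rewrite -scalerAr; apply: tilde_algZ.
by rewrite full_mkM; apply: tilde_alg_mk; exact: admissibleM.
Qed.

Lemma admissible_t k : admissible (t_from m k).
Proof.
rewrite /admissible (_ : mkset _ = set0) // -subset0 => l /=; apply.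
by exists (fun i : 'I_m => (k <= i.+1)%N : nat); rewrite t_fromE.
Qed.

Lemma j_hom_tilde x : tilde_alg (j_hom m x).
Proof.
elim/(@free_ind C gletters): x => [|c w x IH].
  by rewrite [j_hom _ _]word_lift0; exact: tilde_alg0.
rewrite [j_hom _ _]free_lift_linear; apply: tilde_algD IH; apply: tilde_algZ.
rewrite free_lift_word; elim: w => [|a w IH].
  rewrite big_nil; apply: (@tilde_alg_mk (fun l => 1)).
  rewrite /admissible (_ : mkset _ = set0) // -subset0 => l /=; apply.
  by exists (fun=> 0%N); exact: tensor_mk1.
rewrite big_cons; apply: tilde_algM IH; rewrite /j_gen.
elim/big_ind: _ => [||k _]; [exact: tilde_alg0|exact: tilde_algD|].
by apply: tilde_alg_mk; apply: admissible_dfwith; exact: admissible_t.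
Qed.

Lemma j_hom_starhom : is_starhom (j_hom m).
Proof.
apply: free_lift_star => -[k0 a]; rewrite /j_gen star_sum.
apply: eq_bigr => k _ /=.
rewrite [RHS]star_tensor_mk; congr full_mk.
apply/functional_extensionality_dep => l.
have star_pow l' (x : 'I_m -> talg l') :
  star (pow_mk x) = pow_mk (fun i => star (x i)) by exact: star_tensor_mk.
have st l' : star (t_from m k l') = t_from m k l'.
  rewrite star_pow; congr pow_mk; apply/funext => i.
  by case: ifP => _; rewrite ?star1 // star_letter.
have si k' l' (x : talg l') : star (i_at m k' x) = i_at m k' (star x).
  rewrite /i_at; case: ifP => _; rewrite ?star0 // star_pow; congr pow_mk.
  by apply/funext => i; case: ifP => _; rewrite ?star1.
case: dfwithP => [|l' al']; last by rewrite dfwith_out // st.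
rewrite dfwith_in starD starN !si /=.
suff -> : star (tincl (letter a) : talg k0) = tincl (letter (invol a)) by [].
by rewrite /tincl !free_lift_letter star_letter.
Qed.
End Hom.
End CondFree.

Arguments alg : clear implicits.
Arguments free_prod : clear implicits.

(* Main.v *)
From HB Require Import structures.
From mathcomp Require Import finmap.
Require Import Defs.
From mathcomp Require Import all_boot all_order all_algebra.
From mathcomp Require Import complex zify.
From mathcomp Require Import boolp classical_sets functions cardinality fsbigop.
From mathcomp Require Import reals topology normedtype.
Set Implicit Arguments.
Unset Strict Implicit.
Unset Printing Implicit Defensive.
Import Order.TTheory GRing.Theory Num.Theory.
Import numFieldNormedType.Exports.
Local Open Scope ring_scope.

(** In the representation of A~^(m) defined by the state Phi~^(m), the letter t
    of a copy of A~_l is the projection onto the vacuum of that copy, and every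
    copy carries a pair (site l, colour k) with 1 <= k <= m.  The factor
    t_[k,m] off the site l then tests whether all sites other than l are in the
    vacuum at the colours >= k.  These tests increase with k, so by Abel
    summation j_l(a) acts by a on the lowest colour k of the site l such that
    all other sites are in the vacuum from colour k on, and it vanishes if
    there is no such k.

    Starting from the vacuum, only stacks arise: vectors with one excited copy
    at each of the colours 1, ..., h, consecutive colours being excited at
    different sites.  An element x of A_l multiplies the top entry of the stack
    if that entry sits at l, and is pushed on a new colour otherwise ([j_push]);
    on a stack of full height m whose top is not at l it acts as a scalar
    ([j_full_stack]).  Colour 1 carries the state phi_l and all other colours
    carry psi_l.

    Let now x_1, ..., x_n be psi-centred at alternating sites, applied from
    right to left.  In the vacuum, x_i contributes phi(x_i) times the vacuum
    and a stack of height 1.  A stack that has just been raised must grow up to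
    height m before the site of its top can come back: since the sites
    alternate and the new entries are psi-centred, m - 1 letters raise it, one
    more is lost on the full stack, and only then can m letters take it down.
    Hence a return to the vacuum takes 2m + 1 letters in all, including the
    first one ([Phi_excited0]), and for n <= 2m only the product of the
    phi(x_i) survives ([Phi_j_centred]).

    This is the defining property of the conditionally free product, for
    centred alternating products of at most 2m factors.  A linear functional is
    determined on all products of at most 2m factors by these values: centre
    the factors one by one, and merge neighbours from the same algebra; both
    operations only produce shorter products ([centring_determines]).  As every
    word is such a product, the values on a given element are eventually
    constant in m, whence the convergence. *)

(** * The letter t as vacuum projection in the Boolean extension *)

Lemma fsbig_prod_eq0 (C : fieldType) (f : nat -> C) (l : nat) :
  finite_set [set i | f i <> 1]%classic -> f l = 0 ->
  \big[*%R/1]_(i \in [set: nat]%classic) f i = 0.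
Proof.
move=> fin fl0; rewrite (fsbigTE (l |` fset_set [set i | f i <> 1]%classic)%fset).
  by rewrite (big_fsetD1 l) /= ?fset1U1 // fl0 mul0r.
move=> i; rewrite in_fset1U negb_or => /andP[_].
by rewrite in_fset_set // notin_setE => /contrapT.
Qed.

Section BooleanVacuum.
Context {C : numClosedFieldType} {L : invChoiceType}.
Variable f : free_alg C L -> C.
Hypothesis f_scalar : scalar f.
Hypothesis f1 : f 1 = 1.

Let boolean_ext0 : boolean_ext f 0 = 0.
Proof. exact: word_lift0. Qed.

Lemma boolean_ext_t_left y : boolean_ext f (tvar * y) = boolean_ext f y.
Proof.
elim/(@free_ind C (tletters L)): y => [|c w y IH]; first by rewrite mulr0.
rewrite mulrDr -scalerAr !boolean_ext_scalar IH /tvar wordM.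
by rewrite /boolean_ext !word_lift_word /= -word1 f1 mul1r.
Qed.

(** A factor t splits the value of the Boolean extension: as an operator, t b
    sends the vacuum to f b times the vacuum. *)
Lemma boolean_ext_t_tincl y b :
  boolean_ext f (y * (tvar * tincl b)) = f b * boolean_ext f y.
Proof.
have f0 : f 0 = 0.
  by have := f_scalar (-1) 0 0; rewrite scaler0 addr0 mulN1r addNr.
elim/(@free_ind C (tletters L)): y => [|c w y IH].
  by rewrite mul0r boolean_ext0 mulr0.
rewrite mulrDl -scalerAl !boolean_ext_scalar IH mulrDr mulrCA; congr (_ * _ + _).
elim/(@free_ind C L): b {IH} => [|d v b IH].
  by rewrite [tincl 0]word_lift0 !mulr0 boolean_ext0 f0 mul0r.
rewrite [tincl _]free_lift_linear !mulrDr -!scalerAr boolean_ext_scalar IH f_scalar.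
rewrite mulrDl -mulrA; congr (_ * _ + _).
(* Both sides are now values on words; the induction on w carries the block
   already read, which ends at the inserted t at the latest. *)
rewrite -/(tincl (word v)) tincl_word /tvar !wordM /boolean_ext !word_lift_word.
have some_end u : boolean_word f u (map Some v) = f (word (u ++ v)).
  by elim: v u {IH} => [|a v IHv] u /=; rewrite ?cats0 // IHv cat_rcons.
elim: w [::] {IH} => [|[a|] w IHw] u /=; first by rewrite some_end mulrC.
  exact: IHw.
by rewrite IHw mulrCA.
Qed.

Lemma boolean_ext_t_right y : boolean_ext f (y * tvar) = boolean_ext f y.
Proof.
by rewrite -[tvar]mulr1 -(free_lift1 (fun a : L => letter (Some a : tletters L)))
   boolean_ext_t_tincl f1 mul1r.
Qed.
End BooleanVacuum.

(** * Products of elements of the free factors *)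

Section SiteWords.
Context {C : numClosedFieldType} {G : nat -> choiceType}.
Local Notation item := {l : nat & alg C G l}.
Implicit Types (s : seq item) (u v : item).

Definition word_prod s : free_prod C G := \prod_(u <- s) fincl (tagged u).

Definition changes_site : rel item := fun u v => tag v != tag u.

Definition centred (psi : forall l, alg C G l -> C) s :=
  all (fun u => psi (tag u) (tagged u) == 0) s.

Lemma fincl_hom l : is_alghom (@fincl C G l).
Proof. exact: free_lift_hom. Qed.

Lemma word_prod_cat s1 s2 : word_prod (s1 ++ s2) = word_prod s1 * word_prod s2.
Proof. exact: big_cat. Qed.

Lemma word_prod_cons u s : word_prod (u :: s) = fincl (tagged u) * word_prod s.
Proof. exact: big_cons. Qed.

Lemma repeated_site s : ~~ sorted changes_site s ->
  exists p l (x y : alg C G l) q,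
    s = p ++ existT _ l x :: existT _ l y :: q.
Proof.
elim: s => [|[l x] [|[l' y] s] IH] //=.
rewrite negb_and negbK => /orP[/eqP/= ll'|]; last first.
  by move=> /IH[p [l1 [x1 [y1 [q ->]]]]]; exists (existT _ l x :: p), l1, x1, y1, q.
by subst l'; exists [::], l, x, y, s.
Qed.

(** Replacing x by (x - psi x) + psi x in one factor gives a product with that
    factor centred and a product with one factor less.  When all factors are
    centred, either the sites alternate or two neighbours merge. *)
Lemma centring_determines (psi : forall l, alg C G l -> C)
    (D : free_prod C G -> C) (N : nat) :
  (forall l, psi l 1 = 1) -> (forall l, scalar (psi l)) -> scalar D ->
  (forall s, sorted changes_site s -> centred psi s -> (size s <= N)%N ->
     D (word_prod s) = 0) ->
  forall s, (size s <= N)%N -> D (word_prod s) = 0.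
Proof.
move=> psi1 psiL DL Dc s; move: {2}(size s) (erefl (size s)) => n.
elim/ltn_ind: n s => n IH s sn nN.
(* s1 is the part of the product that is already centred. *)
have centre s2 s1 : centred psi s1 -> size (s1 ++ s2) = n ->
    D (word_prod (s1 ++ s2)) = 0.
  elim: s2 s1 => [|[l x] s2 IH2] s1 s1c.
    rewrite cats0 => s1n; have [alt|] := boolP (sorted changes_site s1).
      by apply: Dc; rewrite // s1n -sn.
    move=> /repeated_site[p [l [x [y [q s1E]]]]].
    have -> : word_prod s1 = word_prod (p ++ existT _ l (x * y) :: q).
      rewrite s1E !word_prod_cat !word_prod_cons /=.
      by case: (fincl_hom l) => _ -> _; rewrite -(mulrA (fincl x)).
    have qn : size (p ++ existT _ l (x * y) :: q) = n.-1.
      by rewrite -s1n s1E !size_cat /= !addnS.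
    have n0 : (0 < n)%N by rewrite -s1n s1E size_cat /= addnS.
    apply: (IH n.-1); rewrite ?prednK ?qn //.
    by rewrite (leq_trans (leq_pred _)) // -sn.
  rewrite size_cat /= addnS => s12.
  pose x0 := x - psi l x *: 1.
  have -> : word_prod (s1 ++ existT _ l x :: s2)
      = psi l x *: word_prod (s1 ++ s2) + word_prod (rcons s1 (existT _ l x0) ++ s2).
    rewrite -cats1 -catA !word_prod_cat !word_prod_cons [word_prod [::]]big_nil.
    rewrite /= mulr1 scalerAr -mulrDr -mulr_algl -mulrDl; congr (_ * (_ * _)).
    have [finL _ fin1] := fincl_hom l.
    by rewrite -{1}(subrK (psi l x *: 1) x) addrC finL fin1.
  rewrite DL (IH (size (s1 ++ s2))) //; first last.
  - by rewrite size_cat; apply: leq_trans nN; rewrite sn -s12.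
  - by rewrite size_cat s12.
  rewrite mulr0 add0r; apply: IH2; last by rewrite size_cat size_rcons.
  rewrite /centred all_rcons [all _ _]s1c andbT /x0 /=.
  by rewrite addrC -scaleNr psiL psi1 mulr1 addNr.
exact: (centre s [::]).
Qed.

Lemma cfree_word_prod (phi psi : forall l, alg C G l -> C)
    (Phi : free_prod C G -> C) s :
  is_cfree_product phi psi Phi -> sorted changes_site s -> centred psi s ->
  Phi (word_prod s) = \prod_(u <- s) phi (tag u) (tagged u).
Proof.
move=> [_ PhiP] alt sc; rewrite /word_prod big_tnth [RHS]big_tnth.
apply: (PhiP (size s) (fun i => tag (tnth (in_tuple s) i))
  (fun i => tagged (tnth (in_tuple s) i))).
  move=> i i' ii'; pose u0 := tnth (in_tuple s) i.
  rewrite !(tnth_nth u0) /= ii'; apply/eqP; rewrite eq_sym.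
  by apply: (sortedP u0 alt); rewrite -ii'.
by move=> i; apply/eqP; apply: (allP sc); exact: mem_tnth.
Qed.
End SiteWords.

(** * Embedded copies and vacuum tests in the infinite tensor product *)

(** The copy of A~_l of colour k, for 1 <= k <= m; the colour m + 1 is mapped
    to 0, which is the convention that makes the sums defining j telescope. *)
HB.lock Definition emb (C : numClosedFieldType) (G : nat -> choiceType)
    (m l k : nat) (x : @talg C G l) : full_tensor G m :=
  full_mk (dfwith (fun l => 1 : tensor_pow G m l) (i_at m k x)).

(** In the representation, the projection testing that all sites other than l
    are in the vacuum at the colours >= q. *)
HB.lock Definition t_off (C : numClosedFieldType) (G : nat -> choiceType)
    (m l q : nat) : full_tensor G m :=
  full_mk (dfwith (@t_from C G m q) (1 : tensor_pow G m l)).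

Section Model.
Context {C : numClosedFieldType} {G : nat -> choiceType}.
Variables (phi psi : forall l, alg C G l -> C) (m : nat).
Arguments phi : clear implicits.
Arguments psi : clear implicits.
Hypothesis phi_state : forall l, is_state (phi l).
Hypothesis psi_state : forall l, is_state (psi l).

Local Notation F := (@Phi_tilde C G m phi psi).
Local Notation TP := (@tensor_pow C G m).
Local Notation TA := (@talg C G).
Local Notation FT := (@full_tensor C G m).
Local Notation copyw l z i x := (@dfwith 'I_m (fun=> TA l : Type) z i x).
Local Notation tfrom := (@t_from C G m).
Local Notation emb := (@emb C G m _).
Local Notation t_off := (t_off C G m).
Local Notation item := {l : nat & alg C G l}.
Implicit Types (l k q : nat).

Lemma full_mkM (x y : forall l, TP l) :
  full_mk x * full_mk y = full_mk (fun l => x l * y l).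
Proof. exact: tensor_mkM. Qed.

Lemma pow_mkM l (x y : 'I_m -> TA l) :
  pow_mk x * pow_mk y = pow_mk (fun i => x i * y i) :> TP l.
Proof. exact: tensor_mkM. Qed.

Lemma full_mk1 : full_mk (fun l => 1 : TP l) = 1.
Proof. by []. Qed.

Lemma pow_mk1 l : pow_mk (fun => 1 : TA l) = 1 :> TP l.
Proof. by []. Qed.

Lemma i_at_over k l (x : TA l) : (m < k)%N -> i_at m k x = 0.
Proof. by rewrite /i_at; case: leqP. Qed.

Lemma pow_mk_linear l (z : 'I_m -> TA l) (i : 'I_m) c x y :
  pow_mk (copyw l z i (c *: x + y))
  = c *: pow_mk (copyw l z i x) + pow_mk (copyw l z i y) :> TP l.
Proof. exact: (@tensor_mk_linear C 'I_m (fun _ => TA l)). Qed.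

Lemma full_mk_linear (z : forall l, TP l) l c (x y : TP l) :
  full_mk (dfwith z (c *: x + y))
  = c *: full_mk (dfwith z x) + full_mk (dfwith z y).
Proof. exact: (@tensor_mk_linear C nat (fun l => TP l)). Qed.

Lemma i_at_dfwith (i : 'I_m) l (x : TA l) :
  i_at m i.+1 x = pow_mk (copyw l (fun=> 1) i x).
Proof.
rewrite /i_at ltn_ord; congr pow_mk; apply/funext => j.
have [->|ji] := eqVneq j i; first by rewrite dfwith_in eqxx.
by rewrite eqSS val_eqE (negbTE ji) dfwith_out // eq_sym.
Qed.

Lemma i_at_linear k l c (x y : TA l) : (0 < k)%N ->
  i_at m k (c *: x + y) = c *: i_at m k x + i_at m k y.
Proof.
case: k => // k _; have [mk|km] := leqP m k.
  by rewrite !i_at_over // scaler0 addr0.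
by rewrite !(@i_at_dfwith (Ordinal km)) pow_mk_linear.
Qed.

Lemma emb_linear k l c (x y : TA l) : (0 < k)%N ->
  emb k (c *: x + y) = c *: emb k x + emb k y.
Proof. by move=> k0; rewrite emb.unlock i_at_linear // full_mk_linear. Qed.

Lemma emb_over k l (x : TA l) : (m < k)%N -> emb k x = 0.
Proof.
move=> mk; rewrite emb.unlock i_at_over //.
have := full_mk_linear (fun=> 1) (-1) (0 : TP l) 0.
by rewrite scaler0 addr0 scaleN1r addNr.
Qed.

Lemma embM k l (x y : TA l) : (0 < k)%N ->
  emb k x * emb k y = emb k (x * y).
Proof.
move=> k0; have [mk|km] := ltnP m k; first by rewrite !emb_over // mul0r.
rewrite emb.unlock full_mkM; congr full_mk.
apply/functional_extensionality_dep => l'.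
case: dfwithP => [|l1 ll1]; last by rewrite !dfwith_out // mulr1.
rewrite !dfwith_in /i_at km pow_mkM; congr pow_mk; apply/funext => i.
by case: ifP => // _; rewrite mulr1.
Qed.

Lemma full_mk_comm (x y : forall l, TP l) :
  (forall l, x l * y l = y l * x l) ->
  full_mk x * full_mk y = full_mk y * full_mk x.
Proof.
move=> xy; rewrite !full_mkM; congr full_mk.
exact/functional_extensionality_dep.
Qed.

Lemma emb_comm k k' l l' (x : TA l) (x' : TA l') :
  k != k' -> emb k x * emb k' x' = emb k' x' * emb k x.
Proof.
move=> kk'; rewrite emb.unlock; apply: full_mk_comm => l0.
have [ll0|ll0] := eqVneq l l0; last by rewrite (dfwith_out _ _ ll0) mul1r mulr1.
have [ll'|ll'] := eqVneq l' l0; last by rewrite (dfwith_out _ _ ll') mul1r mulr1.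
subst l0; subst l'; rewrite !dfwith_in /i_at.
case: ifP => _; case: ifP => _; rewrite ?(mulr0, mul0r) // !pow_mkM.
congr pow_mk; apply/funext => i; case: eqP => [->|_]; last by rewrite mul1r mulr1.
by rewrite (negbTE kk') mulr1 mul1r.
Qed.

Lemma emb_t_off k q l (x : TA l) : emb k x * t_off l q = t_off l q * emb k x.
Proof.
rewrite t_off.unlock emb.unlock; apply: full_mk_comm => l0.
case: dfwithP => [|l1 ll1]; first by rewrite dfwith_in mul1r mulr1.
by rewrite mulr1 mul1r.
Qed.

Lemma emb_t_off_lt k q l l' (x : TA l') : (k < q)%N ->
  emb k x * t_off l q = t_off l q * emb k x.
Proof.
move=> kq; rewrite t_off.unlock emb.unlock; apply: full_mk_comm => l0.
have [ll0|ll0] := eqVneq l' l0; last by rewrite (dfwith_out _ _ ll0) mul1r mulr1.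
subst l0; rewrite dfwith_in.
have [ll'|ll'] := eqVneq l l'; first by subst l'; rewrite dfwith_in mul1r mulr1.
rewrite dfwith_out // /i_at; case: ifP => _; last by rewrite mulr0 mul0r.
rewrite !pow_mkM; congr pow_mk; apply/funext => i.
case: eqP => [->|_]; last by rewrite mulr1 mul1r.
by rewrite kq mulr1 mul1r.
Qed.

Lemma admissible1 : admissible (fun l => 1 : TP l).
Proof.
rewrite /admissible (_ : mkset _ = set0) // -subset0 => l /=; apply.
by exists (fun=> 0%N).
Qed.

Lemma tilde_emb k l (x : TA l) : tilde_alg (emb k x).
Proof.
by rewrite emb.unlock; apply/tilde_alg_mk/admissible_dfwith/admissible1.
Qed.

(** The test t_off contains the factor t of each single copy that it tests. *)
Lemma t_off_split l l' q k : l != l' -> (q <= k)%N -> (0 < k)%N -> (k <= m)%N ->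
  exists2 T, tilde_alg T & t_off l q = T * emb k (tvar : TA l').
Proof.
move=> ll' qk k0 km.
pose z := pow_mk (fun i : 'I_m =>
  if (i.+1 < q)%N || (i.+1 == k) then 1 else tvar) : TP l'.
exists (full_mk (dfwith (dfwith (tfrom q) (1 : TP l)) z)).
  by apply/tilde_alg_mk/admissible_dfwith/admissible_dfwith/admissible_t.
rewrite t_off.unlock emb.unlock full_mkM; congr full_mk.
apply/functional_extensionality_dep => l0; have [ll0|ll0] := eqVneq l' l0; last first.
  by rewrite (dfwith_out _ z) // (dfwith_out _ (i_at m k _)) // mulr1.
subst l0; rewrite dfwith_out // !dfwith_in /i_at km pow_mkM /t_from.
congr pow_mk; apply/funext => i.
have [->|_] := eqVneq i.+1 k; first by rewrite ltnNge qk orbT mul1r.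
by rewrite orbF mulr1.
Qed.

Lemma PhiD x y : F (x + y) = F x + F y.
Proof. by rewrite -[x in LHS]scale1r Phi_tilde_scalar // mul1r. Qed.

Lemma Phi0 : F 0 = 0.
Proof. by apply: (addrI (F 0)); rewrite -PhiD !addr0. Qed.

Lemma PhiZ c x : F (c *: x) = c * F x.
Proof. by rewrite -[_ *: _ in LHS]addr0 Phi_tilde_scalar // Phi0 addr0. Qed.

(** The state carried by the copy of colour k at the site l. *)
Definition site_state k l := if k == 1%N then phi l else psi l.
Arguments site_state : clear implicits.

Lemma site_stateP k l : is_state (site_state k l).
Proof. by rewrite /site_state; case: ifP. Qed.

Lemma Phi_site_pow l (z : 'I_m -> TA l) :
  Phi_site (phi l) (psi l) (pow_mk z)
  = \prod_(i < m) boolean_ext (site_state i.+1 l) (z i).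
Proof. by rewrite Phi_site_mk. Qed.

(** * Vectors of the representation up to its left kernel *)

Lemma Phi_full_support (x : forall l, TP l) : admissible x ->
  finite_set [set l | Phi_site (phi l) (psi l) (x l) <> 1]%classic.
Proof.
apply: sub_finite_set => l /= nx [r xr]; apply: nx.
rewrite xr Phi_site_pow big1 // => i _; apply: boolean_ext_tX.
by case: (site_stateP i.+1 l).
Qed.

Lemma Phi_full_eq0 (x : forall l, TP l) l :
  admissible x -> Phi_site (phi l) (psi l) (x l) = 0 -> F (full_mk x) = 0.
Proof.
move=> xP xl0; rewrite Phi_tilde_mk //.
by apply: (@fsbig_prod_eq0 C _ l) => //; exact: Phi_full_support.
Qed.

Lemma Phi_full_eq (x y : forall l, TP l) :
  admissible x -> admissible y ->
  (forall l, Phi_site (phi l) (psi l) (x l) = Phi_site (phi l) (psi l) (y l)) ->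
  F (full_mk x) = F (full_mk y).
Proof.
by move=> xP yP xy; rewrite !Phi_tilde_mk //; apply: eq_fsbigr => l _.
Qed.

Lemma pow_ind l (h h' : TP l -> C) :
  scalar h -> scalar h' -> (forall z, h (pow_mk z) = h' (pow_mk z)) -> h =1 h'.
Proof.
have sc0 (g : TP l -> C) : scalar g -> g 0 = 0.
  by move=> /(_ (-1) 0 0); rewrite scaler0 addr0 mulN1r addNr.
move=> hL h'L hh'; elim/(@tensor_ind C 'I_m) => [|c z x IH].
  by rewrite !sc0.
by rewrite hL h'L IH [tensor_mk _]/(pow_mk z) hh'.
Qed.


Lemma Phi_mul_eq (x y z : forall l, TP l) :
  admissible x -> admissible y -> admissible z ->
  (forall l (w : 'I_m -> TA l), Phi_site (phi l) (psi l) (pow_mk w * x l)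
     = Phi_site (phi l) (psi l) (pow_mk w * y l)) ->
  F (full_mk z * full_mk x) = F (full_mk z * full_mk y).
Proof.
move=> xP yP zP xy; rewrite !full_mkM; apply: Phi_full_eq => [||l].
- exact: admissibleM.
- exact: admissibleM.
apply: (@pow_ind l (fun w => Phi_site (phi l) (psi l) (w * x l))
  (fun w => Phi_site (phi l) (psi l) (w * y l))) => [c v w|c v w|w].
- by rewrite mulrDl -scalerAl Phi_site_scalar.
- by rewrite mulrDl -scalerAl Phi_site_scalar.
exact: xy.
Qed.

(** Equality of the images of x and y in the representation defined by
    Phi~^(m), i.e., modulo its left kernel.  Using this relation instead of the
    quotient space keeps all computations inside the tensor product. *)
Definition eqv (x y : FT) := forall z, tilde_alg z -> F (z * x) = F (z * y).

Lemma eqv_trans y x z : eqv x y -> eqv y z -> eqv x z.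
Proof. by move=> xy yz w wP; rewrite xy // yz. Qed.

Lemma eqvD x x' y y' : eqv x x' -> eqv y y' -> eqv (x + y) (x' + y').
Proof. by move=> xx' yy' z zP; rewrite !mulrDr !PhiD xx' ?yy'. Qed.

Lemma eqvZ c x x' : eqv x x' -> eqv (c *: x) (c *: x').
Proof. by move=> xx' z zP; rewrite -!scalerAr !PhiZ xx'. Qed.

Lemma eqvMl z x y : tilde_alg z -> eqv x y -> eqv (z * x) (z * y).
Proof.
by move=> zP xy w wP; rewrite !mulrA; apply: xy; apply: tilde_algM.
Qed.

Lemma eqv_mk (x y : forall l, TP l) : admissible x -> admissible y ->
  (forall l (w : 'I_m -> TA l), Phi_site (phi l) (psi l) (pow_mk w * x l)
     = Phi_site (phi l) (psi l) (pow_mk w * y l)) ->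
  eqv (full_mk x) (full_mk y).
Proof.
move=> xP yP xy z; elim=> [|c w q wP _ IH]; first by rewrite !mul0r.
rewrite !mulrDl -!scalerAl !PhiD !PhiZ IH; congr (_ * _ + _).
exact: Phi_mul_eq.
Qed.

Lemma site_state1 k l : site_state k l 1 = 1.
Proof. by case: (site_stateP k l). Qed.

Lemma site_state_scalar k l : scalar (site_state k l).
Proof. by case: (site_stateP k l). Qed.

(** The vacuum passes every test. *)
Lemma t_off_eqv1 l q : eqv (t_off l q) 1.
Proof.
rewrite t_off.unlock; apply: (@eqv_mk _ (fun=> 1)) => [||l' w].
- exact/admissible_dfwith/admissible_t.
- exact: admissible1.
move: w; case: dfwithP => // l1 _ w; rewrite mulr1 pow_mkM !Phi_site_pow.
apply: eq_bigr => i _; case: ifP => _; first by rewrite mulr1.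
apply: boolean_ext_t_right; [exact: site_state_scalar|exact: site_state1].
Qed.

Lemma emb1 k l : (k <= m)%N -> emb k (1 : TA l) = 1.
Proof.
move=> km; rewrite -full_mk1 emb.unlock; congr full_mk.
apply/functional_extensionality_dep => l0; case: dfwithP => //.
by rewrite /i_at km -pow_mk1; congr pow_mk; apply/funext => i; case: ifP.
Qed.

(** The projection t b of one copy sends the vacuum to a multiple of it. *)
Lemma emb_t_eqv k l (b : alg C G l) : (0 < k <= m)%N ->
  eqv (emb k (tvar * tincl b)) (site_state k l b *: 1).
Proof.
case: k => // k /= km; pose i := Ordinal km.
set c := site_state _ _ b; set x := tvar * _.
suff x0 : eqv (emb k.+1 (- c *: 1 + x)) 0.
  rewrite -[emb _ _](addNKr (c *: 1 : FT)) -[X in eqv _ X]addr0.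
  rewrite emb_linear // scaleNr emb1 // in x0.
  by apply: eqvD.
move=> z; elim=> [|d w q wP _ IH]; first by rewrite !mul0r.
rewrite !mulr0 Phi0 in IH *; rewrite mulrDl -scalerAl PhiD PhiZ IH addr0.
rewrite -[RHS](mulr0 d); congr (_ * _); rewrite emb.unlock full_mkM.
apply: (@Phi_full_eq0 _ l).
  by apply: admissibleM => //; apply/admissible_dfwith/admissible1.
rewrite dfwith_in (@i_at_dfwith i).
apply: (@pow_ind l (fun v => Phi_site (phi l) (psi l) (v * _)) (fun=> 0)).
- by move=> a u v; rewrite mulrDl -scalerAl Phi_site_scalar.
- by move=> a u v; rewrite mulr0 addr0.
move=> v; rewrite pow_mkM Phi_site_pow (bigD1 i) //= dfwith_in.
rewrite mulrDr -scalerAr mulr1 boolean_ext_scalar.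
rewrite (boolean_ext_t_tincl (@site_state_scalar k.+1 l)).
by rewrite mulNr addNr mul0r.
Qed.

(** A vector can be projected onto the vacuum of a copy before it is paired with
    the vacuum vector. *)
Lemma Phi_emb_t k l x : (0 < k <= m)%N -> tilde_alg x ->
  F (emb k (tvar : TA l) * x) = F x.
Proof.
case: k => // k /= km; pose i := Ordinal km.
elim=> [|d w q wP _ IH]; first by rewrite mulr0.
rewrite mulrDr -scalerAr !PhiD !PhiZ IH; congr (_ * _ + _).
rewrite emb.unlock full_mkM; apply: Phi_full_eq => // [|l0].
  by apply: admissibleM => //; apply/admissible_dfwith/admissible1.
case: dfwithP => [|l1 _]; last by rewrite mul1r.
apply: (@pow_ind l (fun v => Phi_site (phi l) (psi l) (_ * v))
  (Phi_site (phi l) (psi l))).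
- by move=> a u v; rewrite mulrDr -scalerAr Phi_site_scalar.
- by move=> a u v; rewrite Phi_site_scalar.
move=> v; rewrite (@i_at_dfwith i) pow_mkM !Phi_site_pow.
apply: eq_bigr => j _; have [->|ji] := eqVneq j i.
  by rewrite dfwith_in boolean_ext_t_left // site_state1.
by rewrite dfwith_out 1?eq_sym // mul1r.
Qed.

Implicit Types (s : seq item) (u : item).

(** * Stacks of excitations *)

(** The top of the stack is the head of the list, and the colour of an entry is
    its height, so that the top has colour size s. *)
Fixpoint stack s : FT :=
  if s is u :: s' then emb (size s').+1 (tincl (tagged u)) * stack s' else 1.

Definition off_top l s := if s is u :: _ then tag u != l else true.

(** Stacks whose entries are orthogonal to the vacuum of their copy and whose
    consecutive entries sit at different sites. *)
Fixpoint centred_stack s : Prop :=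
  if s is u :: s' then
    [/\ site_state (size s').+1 (tag u) (tagged u) = 0, off_top (tag u) s'
      & centred_stack s']
  else True.

Lemma tilde_stack s : tilde_alg (stack s).
Proof.
elim: s => [|u s IH] /=; last by apply: tilde_algM; first exact: tilde_emb.
exact/tilde_alg_mk/admissible1.
Qed.

Lemma emb_stack k l (x : TA l) s : (size s < k)%N ->
  emb k x * stack s = stack s * emb k x.
Proof.
elim: s => [|u s IH] /= sk; first by rewrite mulr1 mul1r.
by rewrite mulrA emb_comm 1?gtn_eqF // -mulrA IH 1?ltnW // mulrA.
Qed.

Lemma t_off_stack l q s : (size s < q)%N ->
  t_off l q * stack s = stack s * t_off l q.
Proof.
elim: s => [|u s IH] /= sq; first by rewrite mulr1 mul1r.
by rewrite mulrA -emb_t_off_lt // -mulrA IH 1?ltnW // mulrA.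
Qed.

(** A centred top entry is orthogonal to the vacuum, so its copy kills the
    stack when projected onto the vacuum. *)
Lemma emb_t_stack u s : centred_stack (u :: s) -> (size s < m)%N ->
  eqv (emb (size s).+1 (tvar : TA (tag u)) * stack (u :: s)) 0.
Proof.
move=> /= [u0 _ _] sm; rewrite mulrA embM // emb_stack //.
apply: eqv_trans (eqvMl (tilde_stack s) (emb_t_eqv _ _)) _ => //.
by rewrite u0 scale0r mulr0.
Qed.

(** The top of the stack makes fail every test that reaches its colour and
    excludes another site. *)
Lemma t_off_stack0 l q s : centred_stack s -> off_top l s ->
  (0 < q <= size s)%N -> (size s <= m)%N -> eqv (t_off l q * stack s) 0.
Proof.
case: s => [|u s]; first by move=> _ _; case: q.
move=> sP us /andP[q0 qs] sm; have lu : l != tag u by rewrite eq_sym.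
have [T TP ->] := t_off_split lu qs (ltn0Sn _) sm.
rewrite -mulrA -[X in eqv _ X](mulr0 T); apply: eqvMl => //.
exact: emb_t_stack.
Qed.

Lemma Phi_stack0 s : centred_stack s -> (0 < size s <= m)%N -> F (stack s) = 0.
Proof.
case: s => [|u s] // sP sm.
rewrite -(@Phi_emb_t (size s).+1 (tag u)) //; last exact: tilde_stack.
have := emb_t_stack sP sm => /(_ 1); rewrite mul1r mulr0 Phi0; apply.
exact: (tilde_stack [::]).
Qed.

Lemma eqv_sum (I : Type) (r : seq I) (P : pred I) (f g : I -> FT) :
  (forall i, P i -> eqv (f i) (g i)) ->
  eqv (\sum_(i <- r | P i) f i) (\sum_(i <- r | P i) g i).
Proof.
move=> fg; elim/big_rec2: _ => [|i x y Pi xy] //; exact: eqvD (fg _ Pi) xy.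
Qed.

(** * The action of the homomorphism j on stacks *)

Lemma j_genE l (a : letters (G l)) :
  j_gen m a = \sum_(1 <= k < m.+1)
    t_off l k * (emb k (tincl (letter a)) - emb k.+1 (tincl (letter a))).
Proof.
apply: eq_big_nat => k /andP[k0 _]; set x := tincl _.
rewrite [X in _ * X]addrC -[X in _ * (X + _)]scaleN1r emb.unlock t_off.unlock -full_mk_linear.
rewrite full_mkM; congr full_mk.
apply/functional_extensionality_dep => l0.
case: dfwithP => [|l1 ll1]; last by rewrite !dfwith_out // mulr1.
by rewrite !dfwith_in mul1r scaleN1r addrC.
Qed.

(** The tests up to colour size s fail and those beyond it succeed, so the sum
    over k telescopes to emb (size s + 1) minus emb (m + 1), the latter being
    0.  The factor B stands for a further entry at the site l itself, which no
    test of j_gen sees; with B = 1 and size s = m the result is 0. *)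
Lemma letter_stack l (a : letters (G l)) (B : FT) s : tilde_alg B ->
  (forall q, B * t_off l q = t_off l q * B) ->
  centred_stack s -> off_top l s -> (size s <= m)%N ->
  eqv (j_gen m a * (B * stack s))
      (emb (size s).+1 (tincl (letter a)) * (B * stack s)).
Proof.
move=> BP Bt sP ls sm; rewrite j_genE mulr_suml; set x := tincl _.
pose d q := emb q x - emb q.+1 x.
have dP q : tilde_alg (d q).
  rewrite /d -scaleN1r; apply: tilde_algD; first exact: tilde_emb.
  exact/tilde_algZ/tilde_emb.
have dt q : t_off l q * d q = d q * t_off l q.
  by rewrite mulrBr mulrBl !emb_t_off.
(* Here d q commutes with the test of index q, so the test can be moved next to
   the stack. *)
apply: (@eqv_trans (\sum_((size s).+1 <= q < m.+1) d q * (B * stack s))).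
  rewrite (big_cat_nat _ (n := (size s).+1)) //= -[X in eqv _ X]add0r.
  apply: eqvD.
    apply: (@eqv_trans (\sum_(1 <= q < (size s).+1) 0)); last by rewrite big1.
    rewrite big_nat [X in eqv _ X]big_nat; apply: eqv_sum => q qs.
    rewrite dt -!mulrA -[X in eqv _ X](mulr0 (d q)); apply: eqvMl => //.
    rewrite mulrA -Bt -mulrA -[X in eqv _ X](mulr0 B); apply: eqvMl => //.
    exact: t_off_stack0.
  rewrite big_nat [X in eqv _ X]big_nat; apply: eqv_sum => q /andP[sq _].
  rewrite dt -!mulrA; apply: eqvMl => //.
  rewrite mulrA -Bt -mulrA; apply: eqvMl => //.
  rewrite t_off_stack // -[X in eqv _ X]mulr1; apply: eqvMl.
    exact: tilde_stack.
  exact: t_off_eqv1.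
rewrite -mulr_suml /d; under eq_bigr do rewrite -opprB.
by rewrite sumrN telescope_sumr // opprB (emb_over (k := m.+1)) // subr0.
Qed.

Local Notation jf x := (@j_hom C G m (@fincl C G _ x)).

Lemma j_fincl_hom l : is_alghom (fun x : alg C G l => jf x).
Proof.
exact: (is_alghom_comp (free_lift_hom _) (free_lift_hom _)).
Qed.

Lemma j_fincl_linear l c (x y : alg C G l) : jf (c *: x + y) = c *: jf x + jf y.
Proof. by case: (j_fincl_hom l) => /(_ c x y). Qed.

Lemma j_finclM l (x y : alg C G l) : jf (x * y) = jf x * jf y.
Proof. by case: (j_fincl_hom l) => _ ->. Qed.

Lemma j_fincl1 l : jf (1 : alg C G l) = 1.
Proof. by case: (j_fincl_hom l). Qed.

Lemma j_fincl0 l : jf (0 : alg C G l) = 0.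
Proof.
by have := j_fincl_linear (-1) (0 : alg C G l) 0; rewrite scaler0 addr0 scaleN1r addNr.
Qed.

Lemma j_fincl_letter l (a : letters (G l)) : jf (letter a) = j_gen m a.
Proof. by rewrite /fincl free_lift_letter /j_hom free_lift_letter. Qed.

(** The stack s with b added at the site l, b not necessarily centred; in
    particular push s 1 is s itself, so that multiplying the top entry and
    adding a new one become the same operation. *)
Definition push s l (b : alg C G l) : FT :=
  emb (size s).+1 (tincl b) * stack s.

Lemma push_linear s l c (x y : alg C G l) :
  push s (c *: x + y) = c *: push s x + push s y.
Proof.
by rewrite /push [tincl _]free_lift_linear emb_linear // mulrDl -scalerAl.
Qed.

Lemma push1 s l : (size s < m)%N -> push s (1 : alg C G l) = stack s.
Proof. by move=> sm; rewrite /push [tincl _]free_lift1 emb1 // mul1r. Qed.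

Lemma push0 s l : push s (0 : alg C G l) = 0.
Proof.
by have := push_linear s (-1) (0 : alg C G l) 0; rewrite scaler0 addr0 scaleN1r addNr.
Qed.

Lemma push_centre s l (x : alg C G l) : (size s < m)%N ->
  let c := site_state (size s).+1 l x in
  push s x = push s (x - c *: 1) + c *: stack s.
Proof.
move=> sm c; rewrite -{1}(subrK (c *: 1) x) addrC push_linear push1 //.
by rewrite addrC.
Qed.

Lemma site_state_centre k l (x : alg C G l) :
  site_state k l (x - site_state k l x *: 1) = 0.
Proof.
by rewrite addrC -scaleNr site_state_scalar site_state1 mulr1 addNr.
Qed.

Lemma letter_push l (a : letters (G l)) (b : alg C G l) s :
  centred_stack s -> off_top l s -> (size s < m)%N ->
  eqv (j_gen m a * push s b) (push s (letter a * b)).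
Proof.
move=> sP ls sm; rewrite {2}/push [tincl _]free_liftM -embM // -mulrA.
apply: letter_stack => // [|q|]; [exact: tilde_emb|exact: emb_t_off|exact: ltnW].
Qed.

(** A letter at the site l acts on push s b by left multiplication on b, and
    this passes to words by iteration and to all of A_l by linearity.  For
    b = 1 an element is pushed on s, otherwise it multiplies the top. *)
Lemma j_push l (x b : alg C G l) s :
  centred_stack s -> off_top l s -> (size s < m)%N ->
  eqv (jf x * push s b) (push s (x * b)).
Proof.
move=> sP ls sm; elim/(@free_ind C (letters (G l))): x => [|c w x IH].
  by rewrite j_fincl0 !mul0r push0.
rewrite j_fincl_linear !mulrDl -!scalerAl push_linear.
apply: eqvD IH; apply: eqvZ.
elim: w => [|a w IHw]; first by rewrite -word1 j_fincl1 !mul1r.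
rewrite -[a :: w]/([:: a] ++ w) -wordM -/(letter a) j_finclM -!mulrA.
apply: eqv_trans (eqvMl _ IHw) _; first exact: j_hom_tilde.
by rewrite j_fincl_letter; apply: letter_push.
Qed.

(** On a full stack there is no colour left for the site l: letters act by 0,
    hence x acts by its coefficient of the empty word. *)
Lemma j_full_stack l (x : alg C G l) s :
  centred_stack s -> off_top l s -> size s = m ->
  exists c, eqv (jf x * stack s) (c *: stack s).
Proof.
move=> sP ls sm; elim/(@free_ind C (letters (G l))): x => [|c w x [d IH]].
  by exists 0; rewrite j_fincl0 mul0r scale0r.
exists (c * (w == [::])%:R + d).
rewrite j_fincl_linear !mulrDl -!scalerAl scalerDl -scalerA.
apply: eqvD IH; apply: eqvZ.
elim: w => [|a w IHw]; first by rewrite -word1 j_fincl1 mul1r scale1r.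
rewrite -[a :: w]/([:: a] ++ w) -wordM -/(letter a) j_finclM -!mulrA.
apply: eqv_trans (eqvMl _ IHw) _; first exact: j_hom_tilde.
rewrite scale0r -scalerAr -[X in eqv _ X](scaler0 _ (w == [::])%:R).
apply: eqvZ; rewrite j_fincl_letter -{1}[stack s]mul1r.
have L := @letter_stack l a 1 s. apply: eqv_trans (L _ _ _ _ _) _ => //; last 2 first.
- by rewrite sm.
- by rewrite emb_over ?sm // mul0r.
- exact: (tilde_stack [::]).
- by move=> q; rewrite mul1r mulr1.
Qed.

Local Notation jrev s := (@j_hom C G m (word_prod (rev s))).

(** * Returning to the vacuum *)

Lemma jrev_cons u s : jrev (u :: s) = jrev s * jf (tagged u).
Proof.
by rewrite rev_cons /word_prod -cats1 big_cat big_seq1 [j_hom _ _]free_liftM.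
Qed.

Lemma sorted_off_top u s : sorted changes_site (u :: s) ->
  off_top (tag u) s /\ sorted changes_site s.
Proof. by case: s => //= v s /andP[]. Qed.

(** The list r gives the factors in the order in which they act, so its head is
    the next one.  If there are fewer factors than entries, the stack cannot be
    emptied, as a factor removes at most one entry.  If the next factor is not
    at the site of the top, the stack has to be filled first: from height h
    this takes m - h factors, then one factor is spent on the full stack and m
    on emptying it, and the bound says that r is shorter than 2m + 1 - h.
    As r alternates, a factor acting on the top is always followed by one at
    another site. *)
Lemma Phi_excited0 r s :
  sorted changes_site r -> centred psi r -> centred_stack s ->
  (0 < size s <= m)%N ->
  (size r < size s)%N \/
    (if s is v :: _ then off_top (tag v) r else false)
      /\ (size r + size s <= 2 * m)%N ->
  F (jrev r * stack s) = 0.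
Proof.
elim: r s => [|[l x] r IH] s.
  move=> _ _ sP sm _; rewrite [word_prod _]big_nil [j_hom _ _]free_lift1 mul1r.
  exact: Phi_stack0.
move=> /sorted_off_top[/= ur rP] /andP[/= /eqP x0 rc] sP /andP[s0 sm] rs.
have jP := j_hom_tilde m (word_prod (rev r)).
rewrite jrev_cons -mulrA /=.
case: s s0 sm sP rs => [//|[l' b] s] _ sm sP rs.
have [ll'|ll'] := eqVneq l' l; last first.
  (* The site of x is not that of the top: x is pushed, or acts as a scalar. *)
  case: (ltngtP (size s).+1 m) sm => // [sm _|sm _].
    rewrite -[stack _](@push1 (existT _ l' b :: s) l) //.
    rewrite (j_push _ _ sP _ _ jP) // mulr1.
    apply: (IH (existT _ l x :: existT _ l' b :: s)) => //=.
    by right; split=> //; case: rs => /= [|[_]]; lia.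
  have [c cE] := @j_full_stack l x (existT _ l' b :: s) sP ll' sm.
  rewrite (cE _ jP) -scalerAr PhiZ (IH (existT _ l' b :: s)) ?mulr0 //=.
    by rewrite sm leqnn.
  by left; case: rs => /= [|[_]]; rewrite -?sm; lia.
(* Now x multiplies the top entry: the result has a centred part, which keeps
   the height, and a multiple of the stack without its top. *)
subst l'; have {}rs : ((size r).+1 < (size s).+1)%N.
  by case: rs => // -[/=]; rewrite eqxx.
move: (sP) => /= [_ ls sP'].
rewrite -[emb _ _ * _]/(push s b) (j_push _ _ sP' ls sm jP).
rewrite push_centre // mulrDr PhiD -scalerAr PhiZ.
rewrite (IH (existT _ l (x * b - _ *: 1) :: s)) //=; first last.
- by right; split=> //; move: rs sm => /=; lia.
- by split=> //; exact: site_state_centre.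
rewrite IH ?mulr0 ?addr0 //; last by left.
by rewrite (ltnW sm) andbT; case: (size s) rs.
Qed.

(** While the vector is the vacuum, each factor acts at colour 1, where the
    state is phi; the centred part of the result is a stack of height 1, which
    the at most 2m - 1 remaining factors cannot empty. *)
Lemma Phi_jrev_centred r : (0 < m)%N -> (size r <= 2 * m)%N ->
  sorted changes_site r -> centred psi r ->
  F (jrev r) = \prod_(u <- r) phi (tag u) (tagged u).
Proof.
move=> m0; elim: r => [|[l x] r IH].
  move=> _ _ _; rewrite [word_prod _]big_nil [j_hom _ _]free_lift1 big_nil.
  rewrite -full_mk1 Phi_tilde_mk //; last exact: admissible1.
  apply: fsbig1 => l _; rewrite -pow_mk1 Phi_site_pow big1 // => i _.
  exact: (boolean_ext1 (site_state1 _ _)).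
move=> rm /sorted_off_top[/= ur rP] /andP[/= x0 rc]; rewrite big_cons /=.
have jP := j_hom_tilde m (word_prod (rev r)).
rewrite jrev_cons /= -[jf x]mulr1 -[X in _ * (_ * X)]/(stack [::]).
rewrite -(@push1 [::] l) //.
rewrite (j_push _ _ _ _ _ jP) // mulr1 push_centre // mulrDr PhiD.
rewrite (@Phi_excited0 r [:: existT _ l _]) //=; first last.
- by right; split=> //; move: rm => /=; lia.
- by split=> //; exact: site_state_centre.
by rewrite add0r -scalerAr PhiZ mulr1 IH // ltnW.
Qed.

Lemma Phi_j_centred s : (0 < m)%N -> (size s <= 2 * m)%N ->
  sorted changes_site s -> centred psi s ->
  F (j_hom m (word_prod s)) = \prod_(u <- s) phi (tag u) (tagged u).
Proof.
move=> m0 sm alt sc; rewrite -{1}[s]revK Phi_jrev_centred ?size_rev //.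
- by apply: perm_big; rewrite perm_sym -perm_rev.
- rewrite rev_sorted; apply: sub_sorted alt => u v.
  by rewrite /changes_site eq_sym.
- by rewrite /centred all_rev.
Qed.

Lemma Phi_j_cfree Phi s : is_cfree_product phi psi Phi ->
  (0 < m)%N -> (size s <= 2 * m)%N ->
  F (j_hom m (word_prod s)) = Phi (word_prod s).
Proof.
move=> PhiP m0 sm; apply/eqP; rewrite -subr_eq0; apply/eqP.
have [[PhiL _ _] _] := PhiP.
apply: (@centring_determines C G psi (fun x => F (j_hom m x) - Phi x) (2 * m)) => //.
- by move=> l; case: (psi_state l).
- by move=> l; case: (psi_state l).
- move=> c x y; rewrite [j_hom _ _]free_lift_linear Phi_tilde_scalar // PhiL.
  by rewrite mulrBr opprD addrACA.
by move=> {sm}s alt sc sm; rewrite Phi_j_centred // (cfree_word_prod PhiP) // subrr.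
Qed.
End Model.

(** * Agreement with the conditionally free product *)

Theorem theorem4p5 (R : realType) (G : nat -> choiceType)
    (phi psi : forall l : nat, alg R[i] G l -> R[i])
    (phi_state : forall l : nat, is_state (phi l))
    (psi_state : forall l : nat, is_state (psi l))
    (Phi : free_prod R[i] G -> R[i])
    (PhiP : is_cfree_product phi psi Phi) :
  (forall (m n : nat) (k : 'I_n -> nat)
      (w : forall i : 'I_n, seq (letters (G (k i)))),
    (0 < m)%N -> (n <= 2 * m)%N -> alternating k ->
    Phi_tilde phi psi (j_hom m (\prod_(i < n) fincl (word (w i))))
    = Phi (\prod_(i < n) fincl (word (w i))))
  /\
  (forall x : free_prod R[i] G,
    ((fun m : nat => Phi_tilde phi psi (j_hom m x) : R[i]^o) @ \oo
       --> (Phi x : R[i]^o))%classic).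
Proof.
split=> [m n k w m0 nm _|x].
  pose f (i : 'I_n) : {l : nat & alg R[i] G l} := existT _ (k i) (word (w i)).
  have -> : \prod_(i < n) fincl (word (w i)) = word_prod (map f (index_enum 'I_n)).
    by rewrite /word_prod big_map.
  by apply: Phi_j_cfree; rewrite // size_map [index_enum _]unlock -enumT size_enum_ord.
have [[PhiL _ _] _] := PhiP.
have [N NP] : exists N, forall m, (N <= m)%N ->
    Phi_tilde phi psi (j_hom m x) = Phi x.
  elim/(@free_ind R[i] (gletters G)): x => [|c w x [N IH]].
    exists 0%N => m _; rewrite [j_hom _ _]word_lift0 Phi0 //.
    by have := PhiL (-1) 0 0; rewrite scaler0 addr0 mulN1r addNr.
  exists (maxn N (size w).+1) => m; rewrite geq_max => /andP[Nm wm].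
  rewrite [j_hom _ _]free_lift_linear Phi_tilde_scalar // PhiL IH //.
  congr (_ * _ + _).
  pose f (a : gletters G) : {l : nat & alg R[i] G l} :=
    existT _ (tag a) (letter (tagged a)).
  have -> : word w = word_prod (map f w).
    rewrite wordE /word_prod big_map; apply: eq_bigr => -[l a] _.
    by rewrite /fincl free_lift_letter.
  apply: Phi_j_cfree => //; first exact: leq_trans wm.
  by rewrite size_map (leq_trans (ltnW wm)) // leq_pmull.
apply: cvg_near_cst; exists N => // m /= Nm; exact: NP.
Qed.
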